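(* For every integer $n\ge 2$, the average $\mu(\bar m,n):=\frac1n\sum_{m=1}^n\mu(m,n)$ of the expected numbers of bit comparisons required by Quickselect satisfies $$\mu(\bar m,n)=2(n-1)-\frac{8}{n}F_1(n)+\frac{4}{n}F_2(n)+\frac{4}{9}F_3(n)-4F_4(n)+\frac{8}{n}F_5(n),$$ where $$F_1(n):=\sum_{j=3}^{n}\frac{(-1)^j\binom{n}{j}}{(j-1)(j-2)},\qquad F_2(n):=\sum_{j=2}^{n-1}\frac{B_j}{j(1-2^{-j})}\left[\frac{n-\binom{n}{j}}{j-1}-1\right],$$ $$F_3(n):=\sum_{j=2}^{n-1}\frac{(-1)^j\binom{n-1}{j}}{j-1},\qquad F_4(n):=\sum_{j=3}^{n-1}\frac{B_j}{j(j-1)(1-2^{-j})}\left[\frac{n-1-\binom{n-1}{j-1}}{j-2}-1\right],$$ $$F_5(n):=\sum_{j=3}^{n}\frac{(-1)^j\binom{n}{j}}{j(j-1)(j-2)\,[1-2^{-(j-1)}]}.$$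
   Context: Quickselect finds the rank-$m$ (i.e. $m$-th smallest) key among $n$ distinct keys as follows: it selects a pivot uniformly at random from the current set of keys and compares every other key in the set with the pivot, thereby determining the rank $k$ of the pivot. If $k=m$ it returns the pivot; if $k>m$ it recursively finds the rank-$m$ key in the set of keys smaller than the pivot; if $k<m$ it recursively finds the rank-$(m-k)$ key in the set of keys larger than the pivot. All pivot choices are made using randomness independent of the key values. Keys are $n$ independent uniform random variables on $(0,1)$, represented by their binary expansions. Comparing two keys $s\neq t$ costs $\beta(s,t)$ bit comparisons, where $\beta(s,t)$ is the index of the first bit at which the binary expansions of $s$ and $t$ differ. $\mu(m,n)$ denotes the expected total number of bit comparisons (sum of $\beta$ over all key comparisons made) when Quickselect finds the rank-$m$ key among $n$ keys. $B_j$ is the $j$-th Bernoulli number. Empty sums are $0$. *)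

(* Defs.v *)
From HB Require Import structures.
From mathcomp Require Import all_boot all_order all_algebra.
From mathcomp Require Import all_classical all_reals all_analysis.

Set Implicit Arguments.
Unset Strict Implicit.
Unset Printing Implicit Defensive.

Import Order.TTheory GRing.Theory Num.Theory.
Import numFieldNormedType.Exports.

Local Open Scope classical_set_scope.
Local Open Scope ring_scope.

(* The k-th bit (k >= 1) of the binary expansion of x in [0, 1). A dyadic
   rational gets its terminating expansion; such keys form a null set. *)
Definition bit (R : realType) (x : R) (k : nat) : bool :=
  odd (Num.truncn (2 ^+ k * x)).

(* The value 0 is a junk value, for arguments with the same expansion. *)
Definition beta (R : realType) (s t : R) : nat :=
  match pselect (exists k, (0 < k)%N && (bit s k != bit t k)) with
  | left differ => ex_minn differ
  | right _ => 0%N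
  end.

(* The key comparisons made by Quickselect when it looks for the rank-m key of
   the list s of distinct keys. piv is the source of randomness: when the
   current list has l keys, the pivot is the one at position piv l < l. The
   lengths strictly decrease along the recursion, so each piv l is used at most
   once, and fuel = size s is enough. *)
Fixpoint quickselect_rec (R : realType) (piv : nat -> nat) (fuel m : nat)
    (s : seq R) : seq (R * R) :=
  if fuel is fuel'.+1 then
    let p := nth 0 s (piv (size s)) in
    let smaller := [seq x <- s | x < p] in
    let larger := [seq x <- s | p < x] in
    let k := (size smaller).+1 in
    [seq (x, p) | x <- s & x != p] ++
      (if k == m then [::]
       else if (m < k)%N then quickselect_rec piv fuel' m smaller
       else quickselect_rec piv fuel' (m - k) larger)
  else [::].

Definition quickselect (R : realType) (piv : nat -> nat) (m : nat)
    (s : seq R) : seq (R * R) :=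
  quickselect_rec piv (size s) m s.

Definition bit_comparisons (R : realType) (piv : nat -> nat) (m : nat)
    (s : seq R) : nat :=
  (\sum_(c <- quickselect piv m s) beta c.1 c.2)%N.

(* Mutual independence of the families of events F i. *)
Definition mutually_independent (R : realType) (d : measure_display)
    (T : measurableType d) (P : probability T R) (I : finType)
    (F : I -> set (set T)) : Prop :=
  forall (J : {set I}) (E : I -> set T),
    (forall i, i \in J -> F i (E i)) ->
    P (\bigcap_(i in [set` J]) E i) = (\prod_(i in J) P (E i))%E.

(* The sigma-algebras generated by the n keys and by the pivot positions for
   lists of 1, ..., n keys. *)
Definition key_pivot_events (R : realType) (d : measure_display)
    (T : measurableType d) (n : nat) (U : 'I_n -> T -> R)
    (V : nat -> T -> nat) (i : 'I_n + 'I_n) : set (set T) :=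
  match i with
  | inl a => g_sigma_algebra_preimage (U a)
  | inr l => g_sigma_algebra_preimage (V l.+1)
  end.

Definition mu (R : realType) (d : measure_display) (T : measurableType d)
    (P : probability T R) (n : nat) (U : 'I_n -> T -> R)
    (V : nat -> T -> nat) (m : nat) : \bar R :=
  'E_P[fun w => (bit_comparisons (V ^~ w) m [seq U i w | i <- enum 'I_n])%:R].

(* The first n Bernoulli numbers, by the recurrence in bernoulli_sum below. *)
Fixpoint bernoulli_seq (R : numFieldType) (n : nat) : seq R :=
  if n is m.+1 then
    let s := bernoulli_seq R m in
    rcons s (((m == 0)%:R - \sum_(j < m) 'C(m.+1, j)%:R * s`_j) / m.+1%:R)
  else [::].

Definition bernoulli_number (R : numFieldType) (j : nat) : R :=
  (bernoulli_seq R j.+1)`_j.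

Lemma bernoulli_seqE (R : numFieldType) (n : nat) :
  bernoulli_seq R n = [seq bernoulli_number R j | j <- iota 0 n].
Proof.
have sz k : size (bernoulli_seq R k) = k.
  by elim: k => //= k IH; rewrite size_rcons IH.
elim: n => // n IH.
rewrite -addn1 iotaD map_cat -IH /= add0n addn1 /bernoulli_number /=.
rewrite nth_rcons sz.
by rewrite ltnn eqxx cats1.
Qed.

Lemma bernoulli_sum (R : numFieldType) (m : nat) :
  \sum_(j < m.+1) 'C(m.+1, j)%:R * bernoulli_number R j = (m == 0)%:R.
Proof.
rewrite big_ord_recr /= [bernoulli_number R m]/bernoulli_number /= nth_rcons.
have -> : size (bernoulli_seq R m) = m.
  by rewrite bernoulli_seqE size_map size_iota.
rewrite ltnn eqxx binSn mulrC divfK ?pnatr_eq0 // addrC.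
have -> : \sum_(i < m) 'C(m.+1, i)%:R * bernoulli_number R i =
          \sum_(j < m) 'C(m.+1, j)%:R * (bernoulli_seq R m)`_j.
  apply: eq_bigr => i _; congr (_ * _).
  by rewrite bernoulli_seqE (nth_map 0%N) ?size_iota // nth_iota.
by rewrite subrK.
Qed.

Definition F1 (R : realType) (n : nat) : R :=
  \sum_(3 <= j < n.+1)
    (-1) ^+ j * 'C(n, j)%:R / ((j%:R - 1) * (j%:R - 2)).

Definition F2 (R : realType) (n : nat) : R :=
  \sum_(2 <= j < n)
    bernoulli_number R j / (j%:R * (1 - 2 ^- j)) *
    ((n%:R - 'C(n, j)%:R) / (j%:R - 1) - 1).

Definition F3 (R : realType) (n : nat) : R :=
  \sum_(2 <= j < n) (-1) ^+ j * 'C(n.-1, j)%:R / (j%:R - 1).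

Definition F4 (R : realType) (n : nat) : R :=
  \sum_(3 <= j < n)
    bernoulli_number R j / (j%:R * (j%:R - 1) * (1 - 2 ^- j)) *
    ((n%:R - 1 - 'C(n.-1, j.-1)%:R) / (j%:R - 2) - 1).

Definition F5 (R : realType) (n : nat) : R :=
  \sum_(3 <= j < n.+1)
    (-1) ^+ j * 'C(n, j)%:R /
    (j%:R * (j%:R - 1) * (j%:R - 2) * (1 - 2 ^- j.-1)).

(* Main.v *)
(* Two distinct keys in [0, 1) cost one bit comparison for every k >= 0 such that
   they lie in the same dyadic cell of width 2^-k. It thus suffices to count, for
   each k, the key comparisons made inside a common cell. Summed over all ranks m
   and averaged over the pivots, their number in one cell depends only on the
   numbers of keys left of, in and right of the cell, and satisfies a recursion
   with an explicit solution in terms of iterated sums of harmonic numbers. The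
   cells of the keys at level k are independent and uniform among 2^k; Newton's
   forward and backward formulas turn the expectation into a sum of powers
   l^a over the cells l, and Bernoulli's formula into a polynomial in 2^-k. What
   remains is a geometric series for each power of 2^-k.

   The order of the keys is not a product event, so the pivots must be shown
   independent of the whole sigma-algebra generated by the keys. The measurability
   of the cost is not needed: it agrees with a measurable function off a null set
   (ties, keys outside [0, 1), invalid pivot positions). *)

Require Import Defs.
From HB Require Import structures.
From mathcomp Require Import all_boot all_order all_algebra.
From mathcomp Require Import ring lra zify.

Set Implicit Arguments.
Unset Strict Implicit.
Unset Printing Implicit Defensive.

Import Order.TTheory GRing.Theory Num.Theory.

Local Open Scope ring_scope.

(** * Finite differences and power sums *)

(** The sum over the levels makes sense only because the polynomial in q = 2^-k has no constant
    term: the degree-0 part of the term [b * harm2 (a + b).-1] is [harm3 n], exactly what the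
    telescoping terms [harm3 a - harm3 (a + b)] remove. Each q^i then sums to 1 / (1 - 2^-i), whence
    these denominators. The sums of the statement are read off by degree. The differences of [harm3]
    of order 3 and more are explicit rational expressions, while those of order 1 and 2 are [harm2]
    and harmonic numbers, so degrees 1 and 2 are exceptional. Degree 1, with B_1 = -1/2, produces
    [F1]. Degree 2, with B_2 = 1/6, produces [F3] and the first term of [F2]; its constant B_2 / (2
    (1 - 1/4)) = 1/9 explains the 4/9. The higher degrees give the rest of [F2] and all of [F4]. The
    term [harm3 b], which sees only the keys inside the cell, gives [F5]. The pairs with the sought
    rank between their own give 2 (n - 1). *)

Definition fdiff (V : zmodType) (f : nat -> V) (r : nat) : V := f r.+1 - f r.

Definition fdiffn (V : zmodType) (j : nat) (f : nat -> V) : nat -> V :=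
  iter j (@fdiff V) f.

Arguments fdiffn : simpl never.

Lemma fdiffnS (V : zmodType) (f : nat -> V) j r :
  fdiffn j.+1 f r = fdiffn j f r.+1 - fdiffn j f r.
Proof. by []. Qed.

Lemma fdiffnSr (V : zmodType) (f : nat -> V) j :
  fdiffn j.+1 f = fdiffn j (fdiff f).
Proof. exact: iterSr. Qed.

Lemma eq_fdiffn (V : zmodType) (f g : nat -> V) j r :
  f =1 g -> fdiffn j f r = fdiffn j g r.
Proof.
by move=> fg; elim: j r => [|j IH] r; rewrite ?fdiffnS ?IH //; apply: fg.
Qed.

Lemma fdiffn_shift (V : zmodType) (f : nat -> V) a j r :
  fdiffn j (fun r => f (r + a)%N) r = fdiffn j f (r + a)%N.
Proof. by elim: j r => // j IH r; rewrite !fdiffnS !IH. Qed.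

Lemma fdiffn_rev (R : comPzRingType) (f : nat -> R) n j r : (r + j <= n)%N ->
  fdiffn j (fun r => f (n - r)%N) r = (-1) ^+ j * fdiffn j f (n - r - j)%N.
Proof.
elim: j r => [|j IH] r le_n; first by rewrite subn0 mul1r.
rewrite !fdiffnS !IH; [|lia|lia].
have -> : (n - r.+1 - j = n - r - j.+1)%N by lia.
have -> : (n - r - j = (n - r - j.+1).+1)%N by lia.
by rewrite exprS; ring.
Qed.

Lemma newton_forward (R : comPzRingType) (f : nat -> R) n r :
  f (r + n)%N = \sum_(j < n.+1) 'C(n, j)%:R * fdiffn j f r.
Proof.
elim: n f => [|n IH] f; first by rewrite big_ord1 addn0 bin0 mul1r.
have fS : f (r + n.+1)%N = f (r + n)%N + fdiff f (r + n)%N.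
  by rewrite /fdiff addnS addrC subrK.
rewrite fS !IH [RHS]big_ord_recl bin0 mul1r.
under [in RHS]eq_bigr do rewrite lift0 binS natrD mulrDl fdiffnSr.
rewrite big_split /= addrA; congr (_ + _).
rewrite [X in _ = _ + X]big_ord_recr /= bin_small // mul0r addr0.
rewrite big_ord_recl bin0 mul1r; congr (_ + _).
by apply: eq_bigr => i _; rewrite lift0 fdiffnSr.
Qed.

(** The range of [j] does not depend on [m], so the formula can be used under a sum in which [m]
    varies. *)
Lemma newton_forward0 (R : comPzRingType) (f : nat -> R) m n : (m <= n)%N ->
  f m = \sum_(j < n.+1) 'C(m, j)%:R * fdiffn j f 0.
Proof.
move=> mn; rewrite -{1}[m]add0n newton_forward.
rewrite (big_ord_widen n.+1 (fun j => 'C(m, j)%:R * fdiffn j f 0)) //.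
rewrite big_mkcond; apply: eq_bigr => j _; case: ltnP => // /bin_small ->.
by rewrite mul0r.
Qed.

Lemma newton_backward (R : comPzRingType) (f : nat -> R) n :
  f 0 = \sum_(j < n.+1) 'C(n, j)%:R * ((-1) ^+ j * fdiffn j f (n - j)%N).
Proof.
have := newton_forward (fun r => f (n - r)%N) n 0; rewrite add0n subnn => ->.
apply: eq_bigr => j _; rewrite fdiffn_rev ?subn0 //.
by rewrite add0n -ltnS ltn_ord.
Qed.

(** The right-hand side is (-1)^j j! / ((r + 1) ... (r + j + 1)) in binomial form. *)
Lemma fdiffn_invS (F : numFieldType) j r :
  fdiffn j (fun r => r.+1%:R^-1 : F) r =
  (-1) ^+ j / ((r + j).+1%:R * 'C(r + j, j)%:R).
Proof.
elim: j r => [|j IH] r.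
  by rewrite addn0 bin0 mulr1 mul1r.
have nz : 'C((r + j).+1, j.+1)%:R != 0 :> F.
  by rewrite pnatr_eq0 -lt0n bin_gt0; lia.
have e1 : 'C(r.+1 + j, j)%:R = (j.+1%:R / r.+1%:R) * 'C((r + j).+1, j.+1)%:R :> F.
  apply: (mulfI (_ : r.+1%:R != 0)); first by rewrite pnatr_eq0.
  rewrite mulrA mulrCA divff ?pnatr_eq0// mulr1 -!natrM; congr (_%:R).
  by rewrite mul_bin_left addSn; congr (_ * _)%N; lia.
have e2 : 'C(r + j, j)%:R = (j.+1%:R / (r + j).+1%:R) * 'C((r + j).+1, j.+1)%:R :> F.
  apply: (mulfI (_ : (r + j).+1%:R != 0)); first by rewrite pnatr_eq0.
  rewrite mulrA mulrCA divff ?pnatr_eq0// mulr1 -!natrM; congr (_%:R).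
  by rewrite mul_bin_diag.
rewrite fdiffnS !IH e1 e2 addnS !addSn exprS.
have n2 : (r + j).+2%:R = 2 + r%:R + j%:R :> F.
  by rewrite -addn2 natrD natrD; ring.
have n1 : (r + j).+1%:R = 1 + r%:R + j%:R :> F.
  by rewrite -addn1 natrD natrD; ring.
have n3 : r.+1%:R = 1 + r%:R :> F by rewrite -natr1 addrC.
have n4 : j.+1%:R = 1 + j%:R :> F by rewrite -natr1 addrC.
have := pnatr_eq0 F (r + j).+2; have := pnatr_eq0 F (r + j).+1.
have := pnatr_eq0 F r.+1; have := pnatr_eq0 F j.+1.
rewrite n1 n2 n3 n4 => /= /negbT z1 /negbT z2 /negbT z3 /negbT z4.
field.
by rewrite nz z1 z2 z3 z4.
Qed.

(** Bernoulli's formula for sums over 0, ..., N - 1, with the matching convention B_1 = -1/2. In the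
    increment from N to N + 1, the coefficient of N^i is 'C(a + 1, i) times the sum in the
    recurrence of [B] of order a - i, which vanishes unless i = a. *)
Lemma sum_powers_bernoulli (F : numFieldType) (B : nat -> F) :
  (forall m, \sum_(j < m.+1) 'C(m.+1, j)%:R * B j = (m == 0)%:R) ->
  forall a N, a.+1%:R * \sum_(l < N) l%:R ^+ a =
  \sum_(j < a.+1) 'C(a.+1, j)%:R * B j * N%:R ^+ (a.+1 - j) :> F.
Proof.
move=> HB a; elim=> [|N IH].
  rewrite big_ord0 mulr0 big1 // => j _.
  by rewrite expr0n subn_eq0 leqNgt ltn_ord mulr0.
rewrite big_ord_recr /= mulrDr {}IH.
suff -> : a.+1%:R * N%:R ^+ a =
    \sum_(j < a.+1) 'C(a.+1, j)%:R * B j *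
       (N.+1%:R ^+ (a.+1 - j) - N%:R ^+ (a.+1 - j)) :> F.
  rewrite -big_split /=; apply: eq_bigr => j _.
  by rewrite -mulrDr addrC subrK.
have bump j : N.+1%:R ^+ (a.+1 - j) - N%:R ^+ (a.+1 - j) =
    \sum_(i < a.+1 | (i < a.+1 - j)%N) 'C(a.+1 - j, i)%:R * N%:R ^+ i :> F.
  rewrite -natr1 (addrC N%:R) exprDn big_ord_recr /= subnn expr0 mul1r binn mulr1n addrK.
  under eq_bigr do rewrite expr1n mul1r -mulr_natl.
  by rewrite (big_ord_widen a.+1 (fun i => 'C(a.+1 - j, i)%:R * N%:R ^+ i)) ?leq_subr.
under [RHS]eq_bigr => j _.
  rewrite bump mulr_sumr big_mkcond /=.
  over.
rewrite exchange_big /=.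
have step (i : 'I_a.+1) : \sum_(j < a.+1)
   (if (i < a.+1 - j)%N then 'C(a.+1, j)%:R * B j * ('C(a.+1 - j, i)%:R * N%:R ^+ i) else 0)
  = 'C(a.+1, i)%:R * N%:R ^+ i * (a - i == 0)%N%:R :> F.
  rewrite -HB mulr_sumr.
  rewrite (big_ord_widen a.+1 (fun j => 'C(a.+1, i)%:R * N%:R ^+ i * ('C((a - i).+1, j)%:R * B j)));
    last by rewrite ltnS leq_subr.
  rewrite [RHS]big_mkcond; apply: eq_bigr => j _ /=.
  have -> : (j < (a - i).+1)%N = (i < a.+1 - j)%N by have := ltn_ord i; lia.
  case: ifP => // lt_i.
  have /(congr1 (fun n => n%:R : F)) : ('C(a.+1, j) * 'C(a.+1 - j, i) = 'C(a.+1, i) * 'C((a - i).+1, j))%N.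
    have hi := ltn_ord i; have hj := ltn_ord j.
    apply/eqP; rewrite -(eqn_pmul2r (_ : 0 < j`! * i`! * (a.+1 - j - i)`!)%N) ?muln_gt0 ?fact_gt0 //.
    apply/eqP.
    have e1 : ('C(a.+1, j) * (j`! * (a.+1 - j)`!) = a.+1`!)%N by apply: bin_fact; lia.
    have e2 : ('C(a.+1 - j, i) * (i`! * (a.+1 - j - i)`!) = (a.+1 - j)`!)%N by apply: bin_fact; lia.
    have e3 : ('C(a.+1, i) * (i`! * (a.+1 - i)`!) = a.+1`!)%N by apply: bin_fact; lia.
    have e4 : ('C((a - i).+1, j) * (j`! * (a.+1 - j - i)`!) = (a.+1 - i)`!)%N.
      have -> : (a.+1 - j - i = (a - i).+1 - j)%N by lia.
      by rewrite bin_fact; [congr (_`!)|]; lia.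
    nia.
  rewrite !natrM => e.
  transitivity ('C(a.+1, j)%:R * 'C(a.+1 - j, i)%:R * B j * N%:R ^+ i); first by ring.
  by rewrite e; ring.
under eq_bigr do rewrite step.
rewrite big_ord_recr /= subnn eqxx mulr1 binSn big1 ?add0r // => i _.
by rewrite subn_eq0 leqNgt ltn_ord mulr0.
Qed.

(* Newton's formula expands [phi m] into the ['C(m, j)], which count the
   [j]-subsets of [Z] that [c] maps into [S]. *)
Lemma sum_ffun_count (R : comNzRingType) (X Y : finType) (Z : {set X})
    (f : Y -> R) (S : {set Y}) (phi : nat -> R) :
  \sum_(c : {ffun X -> Y})
     (\prod_(i in ~: Z) f (c i)) * phi #|[set i in Z | c i \in S]| =
  (\sum_y f y) ^+ #|~: Z| *
  \sum_(j < #|Z|.+1) 'C(#|Z|, j)%:R *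
     (#|S|%:R ^+ j * #|Y|%:R ^+ (#|Z| - j)) * fdiffn j phi 0.
Proof.
(* A product over the coordinates of [c], so that its sum over all [c] factors: an index in [J]
   gives #|S|, one in [Z] outside [J] gives #|Y|, one outside [Z] gives the sum of [f]. For [J]
   inside [Z], its [S]-factors are 1 exactly when [c] maps [J] into [S]. *)
pose W (J : {set X}) (c : {ffun X -> Y}) : R :=
  \prod_i (if i \in Z then if i \in J then (c i \in S)%:R else 1 else f (c i)).
have phiE (c : {ffun X -> Y}) : (\prod_(i in ~: Z) f (c i)) * phi #|[set i in Z | c i \in S]| =
    \sum_(j < #|Z|.+1)
      \sum_(J : {set X} | (J \subset Z) && (#|J| == j)) W J c * fdiffn j phi 0.
  rewrite (@newton_forward0 _ phi _ #|Z|); last first.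
    by apply/subset_leq_card/subsetP => i; rewrite inE => /andP[].
  rewrite mulr_sumr; apply: eq_bigr => j _.
  rewrite mulrA -mulr_suml; congr (_ * _).
  set A := [set i in Z | c i \in S].
  rewrite -cards_draws -sum1_card natr_sum mulr_sumr.
  rewrite [RHS](bigID (fun J : {set X} => J \subset A)) /= [X in _ + X]big1 ?addr0.
    apply: eq_big => J.
      rewrite inE andbAC; congr (_ && _).
      apply/idP/andP => [JA|[]//]; split=> //; apply: subset_trans JA _.
      by apply/subsetP => i; rewrite inE => /andP[].
    rewrite inE => /andP[JA _]; rewrite mulr1 /W.
    rewrite [RHS](bigID (mem Z)) /= [X in _ = X * _]big1 ?mul1r.
      apply: eq_big => [i|i]; first by rewrite inE.
      by rewrite inE => /negbTE ->.
    move=> i iZ; rewrite iZ; case: ifP => // iJ.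
    by move/subsetP: JA => /(_ _ iJ); rewrite inE => /andP[_ ->].
  move=> J /andP[/andP[/subsetP JZ _] /subsetPn[i iJ]].
  rewrite inE JZ //= => ciS.
  by rewrite /W (bigD1 i) //= JZ // iJ (negbTE ciS) mul0r.
have cS : \sum_y (y \in S)%:R = #|S|%:R :> R.
  rewrite -sum1_card natr_sum [RHS]big_mkcond.
  by apply: eq_bigr => y _; case: (y \in S).
under eq_bigr do rewrite phiE.
rewrite exchange_big mulr_sumr /=; apply: eq_bigr => j _.
rewrite exchange_big /= mulrA.
under eq_bigr do rewrite -mulr_suml.
rewrite -mulr_suml; congr (_ * _).
rewrite mulrCA -cards_draws -[#|[set A | _]|]sum1_card natr_sum mulr_suml.
apply: eq_big => J; first by rewrite inE.
case/andP => JZ /eqP cJ; rewrite mul1r.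
rewrite -(bigA_distr_bigA (fun i y => if i \in Z then if i \in J then (y \in S)%:R else 1 else f y)).
rewrite (bigID (mem Z)) /= [LHS]mulrC; congr (_ * _).
  rewrite (eq_bigl (fun i => i \in ~: Z)); last by move=> i; rewrite in_setC.
  under eq_bigr => i.
    rewrite inE => /negbTE iZ; under eq_bigr do rewrite iZ.
    over.
  by rewrite prodr_const.
rewrite (bigID (mem J)) /=; congr (_ * _).
  rewrite (eq_bigl (fun i => i \in J)); last first.
    by move=> i; rewrite andbC; case: (boolP (i \in J)) => //= /(subsetP JZ) ->.
  under eq_bigr => i iJ.
    under eq_bigr do rewrite (subsetP JZ _ iJ) iJ.
    rewrite cS.
    over.
  by rewrite prodr_const cJ.
rewrite (eq_bigl (fun i => i \in Z :\: J)); last by move=> i; rewrite in_setD andbC.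
under eq_bigr => i.
  rewrite inE => /andP[/negbTE iJ iZ].
  under eq_bigr do rewrite iZ iJ.
  rewrite sumr_const.
  over.
by rewrite prodr_const cardsD (setIidPr JZ) cJ.
Qed.

Lemma sum_ffun_count_setT (R : comNzRingType) (n : nat) (Y : finType)
    (S : {set Y}) (phi : nat -> R) :
  \sum_(c : {ffun 'I_n -> Y}) phi #|[set i | c i \in S]| =
  \sum_(j < n.+1) 'C(n, j)%:R *
     (#|S|%:R ^+ j * #|Y|%:R ^+ (n - j)) * fdiffn j phi 0.
Proof.
have := sum_ffun_count [set: 'I_n] (fun=> 1 : R) S phi.
rewrite setCT cards0 cardsT card_ord expr0 mul1r => <-.
apply: eq_bigr => c _; rewrite big_set0 mul1r; congr (phi _).
by apply: eq_card => i; rewrite !inE.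
Qed.

(** The first factor is a sum over the keys [i] with [c i = y]. Fixing one such [i] leaves n - 1
    free keys, and [#|...|.-1] counts those in [S]. Counting those outside [S] instead is what
    brings in the backward differences; when [S] consists of the cells up to [l], its complement has
    N - 1 - l elements, which suits power sums starting at 0. *)
Lemma sum_ffun_count_mul_compl (R : comNzRingType) (n : nat) (Y : finType)
    (y : Y) (S : {set Y}) (phi : nat -> R) : y \in S ->
  \sum_(c : {ffun 'I_n -> Y})
     #|[set i | c i == y]|%:R * phi #|[set i | c i \in S]|.-1 =
  n%:R * \sum_(j < n) 'C(n.-1, j)%:R *
     (#|~: S|%:R ^+ j * #|Y|%:R ^+ (n.-1 - j)) *
     ((-1) ^+ j * fdiffn j phi (n.-1 - j)%N).
Proof.
move=> yS.
under eq_bigr do rewrite -sum1_card natr_sum mulr_suml big_mkcond.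
rewrite exchange_big /=.
set rhs := (X in _ = _ * X).
have main (i : 'I_n) :
    \sum_(c : {ffun 'I_n -> Y})
      (if i \in [set i | c i == y] then 1 * phi #|[set i | c i \in S]|.-1
       else 0) = rhs.
  have := sum_ffun_count (~: [set i]) (fun z => (z == y)%:R : R) (~: S)
    (fun r => phi (n.-1 - r)%N).
  have n1 : n.-1.+1 = n by case: (n) i => [[]|].
  rewrite setCK cards1 expr1 cardsC1 card_ord n1.
  rewrite (bigD1 y) //= eqxx [X in 1 + X]big1 ?addr0 ?mul1r => [e|z /negbTE -> //].
  transitivity (\sum_(j < n) 'C(n.-1, j)%:R *
      (#|~: S|%:R ^+ j * #|Y|%:R ^+ (n.-1 - j)) *
      fdiffn j (fun r : nat => phi (n.-1 - r)%N) 0); last first.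
    apply: eq_bigr => j _; rewrite fdiffn_rev ?subn0//.
    by have := ltn_ord j; lia.
  rewrite -e; apply: eq_bigr => c _; rewrite big_set1 inE.
  case: eqP => [ciy|]; rewrite ?mul0r// !mul1r; congr (phi _).
  rewrite (cardsD1 i [set i0 | _]) inE ciy yS /=.
  rewrite -[n.-1](_ : #|~: [set i]| = _); last by rewrite cardsC1 card_ord.
  rewrite -(cardsID [set i' | c i' \in S] (~: [set i])).
  rewrite (_ : ~: [set i] :\: _ = [set i0 in ~: [set i] | c i0 \in ~: S]); last first.
    by apply/setP => i'; rewrite !inE andbC.
  rewrite addnK; apply: eq_card => i'.
  by rewrite !inE andbC.
by under eq_bigr do rewrite main; rewrite sumr_const card_ord mulr_natl.
Qed.

Lemma fdiff_sum (V : zmodType) (f : nat -> V) :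
  fdiff (fun r => \sum_(s < r) f s) =1 f.
Proof. by move=> r; rewrite /fdiff big_ord_recr /= addrAC subrr add0r. Qed.

(** Since 'C(n, b) 'C(b, i) = 'C(n, i) 'C(n - i, b - i), the coefficient of [w i] is Newton's
    backward formula for the [i]-th difference of [f] on n - i, without its leading term. Moving
    that term to the other side leaves the difference of the values at n - i and at 0. *)
Lemma bernoulli_newton (F : numFieldType) (f w : nat -> F) n :
  \sum_(b < n) 'C(n, b.+1)%:R * ((-1) ^+ b * fdiffn b.+1 f (n - b.+1)%N) *
     \sum_(i < b.+1) 'C(b.+1, i)%:R * w i =
  \sum_(i < n.+1) 'C(n, i)%:R * w i *
     ((-1) ^+ i * (fdiffn i f (n - i)%N - fdiffn i f 0)).
Proof.
transitivity (\sum_(b < n.+1) \sum_(i < n.+1 | (i < b)%N)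
   'C(n, b)%:R * (- (-1) ^+ b * fdiffn b f (n - b)%N) * ('C(b, i)%:R * w i)).
  rewrite [RHS]big_ord_recl [X in _ = X + _]big1 ?add0r; last by move=> [].
  apply: eq_bigr => b _; rewrite lift0 exprS mulN1r opprK mulr_sumr.
  rewrite (big_ord_widen n.+1 (fun i => 'C(n, b.+1)%:R * ((-1) ^+ b * fdiffn b.+1 f (n - b.+1)%N) *
     ('C(b.+1, i)%:R * w i))) //.
  by have := ltn_ord b; lia.
rewrite (exchange_big_dep xpredT) //; apply: eq_bigr => i _.
have := newton_backward (fdiffn i f) (n - i).
rewrite big_ord_recl bin0 mul1r subn0 mul1r => ->.
rewrite opprD addrA subrr sub0r.
rewrite [RHS]mulrA mulrN mulr_sumr -sumrN.
rewrite -(big_mkord (fun b => (i < b)%N) (fun b => 'C(n, b)%:R * (- (-1) ^+ b * fdiffn b f (n - b)%N) * ('C(b, i)%:R * w i))).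
have hi := ltn_ord i.
rewrite (big_cat_nat (n := i.+1)) // big_nat_cond big1; last first.
  by move=> b /andP[/andP[_ h1] h2]; lia.
rewrite [LHS]add0r -{1}[i.+1]add0n big_addn subSS big_mkord.
apply: eq_big => [b|b _]; first by lia.
have hb := ltn_ord b.
rewrite lift0 addnS -addSn.
have -> : (n - (b.+1 + i) = n - i - b.+1)%N by lia.
rewrite /fdiffn iterD -/(fdiffn i f) -/(fdiffn b.+1 (fdiffn i f)) exprD.
have : 'C(n, b.+1 + i)%:R * 'C(b.+1 + i, i)%:R = 'C(n, i)%:R * 'C(n - i, b.+1)%:R :> F.
  rewrite -!natrM; congr (_%:R).
  apply/eqP; rewrite -(eqn_pmul2r (_ : 0 < i`! * b.+1`! * (n - i - b.+1)`!)%N) ?muln_gt0 ?fact_gt0 //.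
  apply/eqP.
  have e1 : ('C(n, i) * (i`! * (n - i)`!) = n`!)%N by apply: bin_fact; lia.
  have e2 : ('C(n - i, b.+1) * (b.+1`! * (n - i - b.+1)`!) = (n - i)`!)%N by apply: bin_fact; lia.
  have e3 : ('C(n, b.+1 + i) * ((b.+1 + i)`! * (n - i - b.+1)`!) = n`!)%N.
    by rewrite -subnDA addnC bin_fact //; lia.
  have e4 : ('C(b.+1 + i, i) * (i`! * b.+1`!) = (b.+1 + i)`!)%N.
    by rewrite -{2}(addnK i b.+1) bin_fact //; lia.
  move: e1 e2 e3 e4.
  move: 'C(n, i) 'C(n - i, b.+1) 'C(n, b.+1 + i) 'C(b.+1 + i, i) => x1 x2 x3 x4.
  move: i`! b.+1`! ((n - i - b.+1)`!) (n`!) ((n - i)`!) ((b.+1 + i)`!).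
  move=> y1 y2 y3 y4 y5 y6 e1 e2 e3 e4.
  transitivity y4; last by rewrite -e1 -e2; ring.
  by rewrite -e3 -e4; ring.
move=> e.
set D := fdiffn b.+1 _ _.
transitivity (- ('C(n, b.+1 + i)%:R * 'C(b.+1 + i, i)%:R * w i * (-1) ^+ i * (-1) ^+ b.+1 * D)).
  by ring.
by rewrite e; ring.
Qed.

(** * Iterated sums of harmonic numbers *)

(* [harm2 F r] is the sum of H_2, ..., H_(r+1), where H is [harm F]; starting at
   H_2 makes both [harm2] and [harm3] vanish at 0. *)
Definition harm (F : numFieldType) (r : nat) : F := \sum_(s < r) s.+1%:R^-1.

Definition harm2 (F : numFieldType) (r : nat) : F := \sum_(s < r) harm F s.+2.

Definition harm3 (F : numFieldType) (r : nat) : F := \sum_(s < r) harm2 F s.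

(* Let a dyadic cell contain [b] of the keys, with [a] smaller and [c] larger
   keys outside it. For i < j in the cell, keys of ranks i and j are compared
   with probability 2 / (max(m, j) - min(m, i) + 1) when rank m is sought;
   [cell_cost] is the sum of this over m and over such i < j. The ranks m in
   [i, j] contribute b (b - 1), the ranks m < i the part depending on [a], and
   the ranks m > j the part depending on [c]. *)
Definition below_cost (F : numFieldType) (a b : nat) : F :=
  b%:R * harm2 F (a + b).-1 - harm3 F (a + b) + harm3 F a - harm3 F b.

Definition cell_cost (F : numFieldType) (a b c : nat) : F :=
  b%:R * (b%:R - 1) + 2 * below_cost F a b + 2 * below_cost F c b.

Lemma harm_fdiff (F : numFieldType) : fdiff (harm F) =1 (fun r => r.+1%:R^-1).
Proof. exact: fdiff_sum. Qed.

Lemma harm2_fdiff (F : numFieldType) :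
  fdiff (harm2 F) =1 (fun r => harm F (r + 2)%N).
Proof. by move=> r; rewrite addn2; apply: (fdiff_sum (fun s => harm F s.+2)). Qed.

Lemma harm3_fdiff (F : numFieldType) : fdiff (harm3 F) =1 harm2 F.
Proof. exact: fdiff_sum. Qed.

(* Summed over the ranks m, the expected number of comparisons between keys in a
   common cell of width 1 / N is the polynomial in 1 / N without constant term
   whose coefficient of degree i is [level_coef B n i]. *)
Definition level_coef (F : numFieldType) (B : nat -> F) (n i : nat) : F :=
  (i == 1)%:R * (n%:R * (n%:R - 1)) +
  4 * ('C(n, i)%:R * B i *
        ((-1) ^+ i * (fdiffn i (harm3 F) (n - i)%N - fdiffn i (harm3 F) 0))
       - 'C(n, i.+1)%:R * fdiffn i.+1 (harm3 F) 0).

(** * Means of the cell costs over uniformly distributed keys *)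

Lemma sum_choose2 (F : numFieldType) (n : nat) (N : nat) : (0 < N)%N ->
  (\sum_(c : {ffun 'I_n -> 'I_N}) \sum_(l < N)
     #|[set i | c i == l]|%:R * (#|[set i | c i == l]|%:R - 1)) / N%:R ^+ n
  = n%:R * (n%:R - 1) / N%:R :> F.
Proof.
move=> N0; have NF : N%:R != 0 :> F by rewrite pnatr_eq0 -lt0n.
(* Only the second difference of b (b - 1) is nonzero at 0, so a single term of Newton's formula
   survives. *)
pose phi b : F := b%:R * (b%:R - 1).
have d0 : fdiffn 0 phi 0 = 0 by rewrite /fdiffn /= /phi mul0r.
have d1 : fdiffn 1 phi 0 = 0 by rewrite /fdiffn /= /fdiff /phi; ring.
have d2 : fdiff (fdiff phi) =1 (fun=> 2).
  by move=> r; rewrite /fdiff /phi -!natr1; ring.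
have d3 : fdiff (fdiff (fdiff phi)) =1 (fun=> 0).
  by move=> r; rewrite [LHS]/fdiff !d2 subrr.
have dn j : fdiffn j.+3 phi 0 = 0.
  rewrite !fdiffnSr (eq_fdiffn _ _ d3).
  by elim: j 0%N => // j IH r; rewrite fdiffnS !IH subrr.
have main (l : 'I_N) : (\sum_(c : {ffun 'I_n -> 'I_N}) phi #|[set i | c i == l]|) / N%:R ^+ n =
    n%:R * (n%:R - 1) / N%:R ^+ 2.
  have := @sum_ffun_count_setT F n 'I_N [set l] phi.
  rewrite cards1 card_ord => e.
  under eq_bigr => c _.
    rewrite (_ : [set i | c i == l] = [set i | c i \in [set l]]); last first.
      by apply/setP => i; rewrite !inE.
    over.
  rewrite e; case: n {e} => [|[|n]].
  - by rewrite big_ord1 d0 mulr0 !mul0r.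
  - by rewrite 2!big_ord_recl big_ord0 d0 d1 !mulr0 !addr0 subrr mulr0 !mul0r.
  rewrite 3!big_ord_recl big1 => [|i _]; last by rewrite !lift0 dn mulr0.
  rewrite d0 d1 !mulr0 !add0r addr0 !lift0 expr1n mul1r.
  have -> : fdiffn 2 phi 0 = 2 by rewrite /fdiffn /= d2.
  have <- : 'C(n.+2, 2)%:R * 2 = n.+2%:R * (n.+2%:R - 1) :> F.
    rewrite -[2]/(2`!%:R) -natrM bin_ffact !ffactnS ffactn0 muln1 natrM /=.
    by rewrite -[n.+2%:R]natr1 addrK.
  have -> : N%:R ^+ n.+2 = N%:R ^+ 2 * N%:R ^+ n :> F by rewrite -exprD.
  by rewrite !subSS subn0; field; rewrite expf_neq0 // NF.
rewrite exchange_big /= mulr_suml.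
under eq_bigr do rewrite main.
by rewrite sumr_const card_ord -mulr_natl; field.
Qed.

Lemma card_rev_gt (n N : nat) (c : {ffun 'I_n -> 'I_N}) (l : 'I_N) :
  (#|[set i | ([ffun i => rev_ord (c i)] i < rev_ord l)%N]| =
   #|[set i | (l < c i)%N]|) *
  (#|[set i | [ffun i => rev_ord (c i)] i == rev_ord l]| =
   #|[set i | c i == l]|).
Proof.
split; apply: eq_card => i; rewrite !inE ffunE.
  by have := ltn_ord (c i); have := ltn_ord l; rewrite /=; lia.
by rewrite (inj_eq rev_ord_inj).
Qed.

(** Reversing the order of the cells permutes the assignments [c] and exchanges the keys left of a
    cell with those right of its mirror image. *)
Lemma sum_below_cost_sym (F : numFieldType) (n N : nat) :
  \sum_(c : {ffun 'I_n -> 'I_N}) \sum_(l < N)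
     below_cost F #|[set i | (l < c i)%N]| #|[set i | c i == l]| =
  \sum_(c : {ffun 'I_n -> 'I_N}) \sum_(l < N)
     below_cost F #|[set i | (c i < l)%N]| #|[set i | c i == l]|.
Proof.
rewrite [RHS](reindex_inj (h := fun c : {ffun 'I_n -> 'I_N} =>
   [ffun i => rev_ord (c i)])); last first.
  move=> c c' /ffunP cc'; apply/ffunP => i; have := cc' i.
  by rewrite !ffunE => /rev_ord_inj.
apply: eq_bigr => c _.
rewrite [RHS](reindex_inj rev_ord_inj); apply: eq_bigr => l _ /=.
by rewrite !card_rev_gt.
Qed.

Lemma card_ord_lt (N k : nat) : (k <= N)%N -> #|[set z : 'I_N | (z < k)%N]| = k.
Proof.
move=> kN; rewrite -sum1dep_card -(big_ord_widen N (fun=> 1%N)) //.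
by rewrite sum1_card card_ord.
Qed.

(** Of the terms of [below_cost], only the product with [harm2] needs power sums ([T2]);
    [harm3 (a + b) - harm3 a] telescopes over the cells ([T3]), and [harm3 b] involves one cell at a
    time ([T4]). *)
Lemma sum_below_cost (F : numFieldType) (B : nat -> F) :
  (forall m, \sum_(j < m.+1) 'C(m.+1, j)%:R * B j = (m == 0)%:R) ->
  forall n N, (0 < N)%N ->
  (\sum_(c : {ffun 'I_n -> 'I_N}) \sum_(l < N)
     below_cost F #|[set i | (c i < l)%N]| #|[set i | c i == l]|) / N%:R ^+ n =
  \sum_(i < n) ('C(n, i.+1)%:R * B i.+1 *
        ((-1) ^+ i.+1 * (fdiffn i.+1 (harm3 F) (n - i.+1)%N - fdiffn i.+1 (harm3 F) 0))
       - 'C(n, i.+2)%:R * fdiffn i.+2 (harm3 F) 0) / N%:R ^+ i.+1.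
Proof.
move=> HB n N N0; have NF : N%:R != 0 :> F by rewrite pnatr_eq0 -lt0n.
have H30 : harm3 F 0 = 0 by rewrite /harm3 big_ord0.
have H31 : fdiff (harm3 F) 0 = 0 by rewrite harm3_fdiff /harm2 big_ord0.
have cAB (c : {ffun 'I_n -> 'I_N}) (l : 'I_N) :
    (#|[set i | (c i < l)%N]| + #|[set i | c i == l]|)%N = #|[set i | (c i <= l)%N]|.
  rewrite -(cardsID [set i | (c i < l)%N] [set i | (c i <= l)%N]).
  congr (_ + _)%N; apply: eq_card => i; rewrite !inE; last by rewrite -val_eqE /=; lia.
  by lia.
have T2 : (\sum_(c : {ffun 'I_n -> 'I_N}) \sum_(l < N)
      #|[set i | c i == l]|%:R * harm2 F #|[set i | (c i <= l)%N]|.-1) / N%:R ^+ n =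
    \sum_(i < n.+1) 'C(n, i)%:R * (B i / N%:R ^+ i) *
       ((-1) ^+ i * (fdiffn i (harm3 F) (n - i)%N - fdiffn i (harm3 F) 0)).
  rewrite -(bernoulli_newton (harm3 F) (fun i => B i / N%:R ^+ i)) exchange_big /=.
  have card_le (l : 'I_N) : #|~: [set z : 'I_N | (z <= l)%N]| = (N - l.+1)%N.
    have := cardsC [set z : 'I_N | (z < l.+1)%N].
    by rewrite card_ord_lt // card_ord => e; apply: (@addnI l.+1); rewrite subnKC.
  under eq_bigr => l _.
    under eq_bigr => c _.
      rewrite (_ : [set i | (c i <= l)%N] = [set i | c i \in [set z : 'I_N | (z <= l)%N]]); last first.
        by apply/setP => i; rewrite !inE.
      over.
    rewrite (@sum_ffun_count_mul_compl F n 'I_N l) ?inE // card_le card_ord.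
    over.
  (* Numbering the cells from the right turns the N - (l + 1) cells above [l] into [l], and the sum
     over the cells into a sum of l^j over l < N. *)
  rewrite [in LHS](reindex_inj rev_ord_inj) -mulr_sumr.
  under [in LHS]eq_bigr => l _.
    rewrite (_ : (N - (rev_ord l).+1)%N = l); last first.
      by rewrite /=; have := ltn_ord l; lia.
    over.
  rewrite [in LHS]exchange_big mulr_sumr mulr_suml; apply: eq_bigr => j _.
  transitivity (n%:R * 'C(n.-1, j)%:R * ((-1) ^+ j * fdiffn j (harm2 F) (n.-1 - j)%N) *
     N%:R ^+ (n.-1 - j) / N%:R ^+ n * \sum_(l < N) l%:R ^+ j).
    by rewrite mulr_sumr mulr_sumr mulr_suml; apply: eq_bigr => l _; ring.
  have j1 : j.+1%:R != 0 :> F by rewrite pnatr_eq0.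
  apply: (mulfI j1).
  rewrite mulrCA (sum_powers_bernoulli HB).
  have -> : \sum_(i < j.+1) 'C(j.+1, i)%:R * B i * N%:R ^+ (j.+1 - i) =
      N%:R ^+ j.+1 * \sum_(i < j.+1) 'C(j.+1, i)%:R * (B i / N%:R ^+ i).
    rewrite mulr_sumr; apply: eq_bigr => i _.
    by rewrite expfB_cond ?(negbTE NF) //=; [ring | have := ltn_ord i; lia].
  have -> : fdiffn j.+1 (harm3 F) (n - j.+1)%N = fdiffn j (harm2 F) (n.-1 - j)%N.
    rewrite fdiffnSr (eq_fdiffn _ _ (@harm3_fdiff F)); congr fdiffn; lia.
  have -> : n%:R * 'C(n.-1, j)%:R = j.+1%:R * 'C(n, j.+1)%:R :> F.
    by rewrite -!natrM mul_bin_diag.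
  have -> : N%:R ^+ n = N%:R ^+ (n.-1 - j) * N%:R ^+ j.+1 :> F.
    by rewrite -exprD; congr (_ ^+ _); have := ltn_ord j; lia.
  set S := \sum_(i < j.+1) _.
  by field; rewrite !expf_neq0.
have T3 (c : {ffun 'I_n -> 'I_N}) : \sum_(l < N)
    (harm3 F #|[set i | (c i <= l)%N]| - harm3 F #|[set i | (c i < l)%N]|) = harm3 F n.
  rewrite -(big_mkord xpredT (fun l => harm3 F #|[set i | (c i < l.+1)%N]| - harm3 F #|[set i | (c i < l)%N]|)).
  rewrite (telescope_sumr (fun l => harm3 F #|[set i | (c i < l)%N]|)) //.
  rewrite (_ : [set i | (c i < N)%N] = setT) ?cardsT ?card_ord; last first.
    by apply/setP => i; rewrite !inE ltn_ord.
  rewrite (_ : [set i | (c i < 0)%N] = set0) ?cards0 ?H30 ?subr0 //.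
have T4 : (\sum_(c : {ffun 'I_n -> 'I_N}) \sum_(l < N)
      harm3 F #|[set i | c i == l]|) / N%:R ^+ n =
    \sum_(i < n) 'C(n, i.+2)%:R * fdiffn i.+2 (harm3 F) 0 / N%:R ^+ i.+1.
  rewrite exchange_big /=.
  under eq_bigr => l _.
    under eq_bigr => c _.
      rewrite (_ : [set i | c i == l] = [set i | c i \in [set l]]); last first.
        by apply/setP => i; rewrite !inE.
      over.
    rewrite (@sum_ffun_count_setT F n 'I_N [set l]) cards1 card_ord.
    over.
  rewrite sumr_const card_ord -[X in X / _]mulr_natl mulr_sumr mulr_suml.
  rewrite big_ord_recl (_ : fdiffn (@ord0 n) _ _ = 0) // !mulr0 mul0r add0r.
  transitivity (\sum_(i < n.+1) 'C(n, i.+1)%:R * fdiffn i.+1 (harm3 F) 0 / N%:R ^+ i).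
    rewrite [RHS]big_ord_recr bin_small // !mul0r [RHS]addr0.
    apply: eq_bigr => i _; rewrite lift0 expr1n mul1r.
    have -> : N%:R ^+ n = N%:R * (N%:R ^+ (n - i.+1) * N%:R ^+ i) :> F.
      by rewrite -exprD -exprS; congr (_ ^+ _); have := ltn_ord i; lia.
    by field; rewrite !expf_neq0.
  (* The N equal cells lower the degree in 1 / N by one; as the differences of order 0 and 1 vanish
     at 0, the degrees still start at 1. *)
  rewrite big_ord_recl (_ : fdiffn (@ord0 n).+1 _ _ = 0) // mulr0 mul0r add0r.
  by apply: eq_bigr => i _; rewrite lift0.
transitivity ((\sum_(c : {ffun 'I_n -> 'I_N}) \sum_(l < N)
      #|[set i | c i == l]|%:R * harm2 F #|[set i | (c i <= l)%N]|.-1) / N%:R ^+ n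
   - harm3 F n - (\sum_(c : {ffun 'I_n -> 'I_N}) \sum_(l < N)
      harm3 F #|[set i | c i == l]|) / N%:R ^+ n).
  have -> : harm3 F n = (\sum_(c : {ffun 'I_n -> 'I_N}) harm3 F n) / N%:R ^+ n.
    rewrite sumr_const card_ffun !card_ord -natrX -[X in X / _]mulr_natr mulfK //.
    by rewrite natrX expf_neq0.
  rewrite -!mulrBl -!sumrB; congr (_ / _); apply: eq_bigr => c _.
  rewrite -(T3 c) -!sumrB; apply: eq_bigr => l _.
  by rewrite /below_cost cAB; ring.
have f0 r : fdiffn (@ord0 n) (harm3 F) r = harm3 F r by [].
(* The degree-0 term of [T2] is B_0 (harm3 n - harm3 0) = harm3 n, and cancels against the
   telescoped sum. *)
rewrite T2 T4 big_ord_recl subn0 bin0 !f0 H30 expr0 !mul1r subr0 divr1.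
have -> : B 0 = 1 by have := HB 0; rewrite big_ord1 bin0 mul1r.
rewrite mul1r (addrC (harm3 F n)) addrK -sumrB; apply: eq_bigr => i _.
by rewrite lift0; ring.
Qed.

(** * The recursion satisfied by the cell costs *)

Lemma harmS (F : realFieldType) r : harm F r.+1 = harm F r + r.+1%:R^-1.
Proof. by rewrite /harm big_ord_recr. Qed.

Lemma harm2S (F : realFieldType) r : harm2 F r.+1 = harm2 F r + harm F r.+2.
Proof. by rewrite /harm2 big_ord_recr. Qed.

Lemma harm3S (F : realFieldType) r : harm3 F r.+1 = harm3 F r + harm2 F r.
Proof. by rewrite /harm3 big_ord_recr. Qed.

Lemma harm2E (F : realFieldType) r : harm2 F r = r.+2%:R * (harm F r.+1 - 1).
Proof.
elim: r => [|r IH]; first by rewrite /harm2 /harm big_ord0 big_ord1 invr1 subrr mulr0.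
rewrite harm2S IH !harmS.
have r0 : 0 <= r%:R :> F by rewrite ler0n.
by field; rewrite -?andbA; repeat (apply/andP; split); apply: lt0r_neq0; lra.
Qed.

Lemma below_cost_b0 (F : realFieldType) a : below_cost F a 0 = 0.
Proof. by rewrite /below_cost addn0 mul0r {3}/harm3 big_ord0 subr0 sub0r addNr. Qed.

Lemma below_costSl (F : realFieldType) a b :
  below_cost F a.+1 b = below_cost F a b +
   (b%:R * harm F (a + b).+1 - harm2 F (a + b) + harm2 F a).
Proof.
case: b => [|b]; first by rewrite !below_cost_b0 !addn0 mul0r; ring.
rewrite /below_cost !addSn !addnS /= !harm3S harm2S; ring.
Qed.

Lemma below_costSr (F : realFieldType) a b :
  below_cost F a b.+1 = below_cost F a b +
   (b%:R * harm F (a + b).+1 - harm2 F b).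
Proof.
rewrite /below_cost addnS /= !harm3S -natr1.
case: b => [|b]; first by rewrite addn0 !mul0r /harm2 /harm3 !big_ord0; ring.
by rewrite addnS /= harm2S; ring.
Qed.

(** With a closed form, the recursion [below_cost0_rec], which involves all smaller arguments, is
    checked in one induction step. *)
Lemma below_cost0 (F : realFieldType) b :
  2 * below_cost F 0 b = - 4 * (b%:R + 1) * harm F b.+1 + b%:R ^+ 2 + 7 * b%:R + 4.
Proof.
elim: b => [|b IH]; first by rewrite below_cost_b0 /harm big_ord1 invr1; ring.
rewrite below_costSr mulrDr IH add0n harm2E [harm F b.+2]harmS -[b.+2%:R]natr1.
rewrite -[b.+1%:R]natr1.
have b0 : 0 <= b%:R :> F by rewrite ler0n.
by field; apply: lt0r_neq0; lra.
Qed.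

Lemma below_cost0_rec (F : realFieldType) b :
  b%:R * (2 * below_cost F 0 b) =
  \sum_(j < b) (j%:R * (j%:R - 1) + 2 * (2 * below_cost F 0 j)).
Proof.
elim: b => [|b IH]; first by rewrite mul0r big_ord0.
rewrite big_ord_recr /= -IH !below_cost0 [harm F b.+2]harmS -[b.+2%:R]natr1 -[b.+1%:R]natr1.
have b0 : 0 <= b%:R :> F by rewrite ler0n.
by field; apply: lt0r_neq0; lra.
Qed.

(** One of the two halves into which the recursion of [cell_cost] splits. In the induction on [a],
    the increment [D] satisfies a recursion of its own in [b], namely [DE], which follows from D (b
    + 1) - D b = b / (a + b + 2). *)
Lemma below_cost_rec (F : realFieldType) a b :
  (a + b)%:R * (2 * below_cost F a b) =
  \sum_(i < a) (2 * below_cost F i b + b%:R * (b%:R - 1)) +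
  \sum_(j < b) (2 * below_cost F a j + (j%:R * (j%:R - 1) + 2 * below_cost F 0 j)).
Proof.
elim: a => [|a IH].
  rewrite big_ord0 !add0r add0n below_cost0_rec; apply: eq_bigr => j _.
  by ring.
rewrite big_ord_recr /=.
under [X in _ = _ + X]eq_bigr => j _ do rewrite below_costSl mulrDr addrAC.
rewrite [X in _ = _ + X]big_split /=.
set D := fun b => b%:R * harm F (a + b).+1 - harm2 F (a + b) + harm2 F a.
have DE b' : (a.+1 + b')%:R * (2 * D b') = \sum_(j < b') 2 * D j + b'%:R * (b'%:R - 1).
  elim: b' => [|b' IHb].
    by rewrite big_ord0 /D !addn0; ring.
  rewrite big_ord_recr /=.
  have -> : D b'.+1 = D b' + b'%:R / (a + b').+2%:R.
    rewrite /D addnS harm2S harmS -[b'.+1%:R]natr1.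
    have z : (a + b')%:R >= 0 :> F by rewrite ler0n.
    by field; apply: lt0r_neq0; lra.
  have e : (a.+1 + b'.+1)%:R = (a + b').+2%:R :> F by rewrite addSn addnS.
  rewrite mulrDr mulrDr {2}e [2 * (b'%:R / _)]mulrCA [(a + b').+2%:R * _]mulrCA.
  rewrite [(a + b').+2%:R * _]mulrCA divff ?pnatr_eq0 // addnS -natr1 [(_ + 1) * _]mulrDl.
  by rewrite IHb -[b'.+1%:R]natr1; ring.
rewrite -[(a.+1 + b)%:R]/((a + b).+1%:R) below_costSl -/(D b) mulrDr mulrDr.
rewrite (DE b) -[(a + b).+1%:R]natr1 mulrDl IH; ring.
Qed.

(** Quickselect's recursion, multiplied by the number a + b + c of possible pivots. A pivot left of
    the cell keeps some [i < a] of the left keys together with the cell, and symmetrically on the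
    right. A pivot in the cell costs b - 1 comparisons inside it for each of the a + b + c ranks and
    cuts the cell in two. Sublists without keys in the cell cost nothing. *)
Lemma cell_cost_rec (F : realFieldType) a b c :
  (a + b + c)%:R * cell_cost F a b c =
  (a + b + c)%:R * (b%:R * (b%:R - 1)) +
  \sum_(i < a) cell_cost F i b c +
  \sum_(j < b) (cell_cost F a j 0 + cell_cost F 0 j c) +
  \sum_(k < c) cell_cost F a b k.
Proof.
have -> : (a + b + c)%:R * cell_cost F a b c =
    (a + b + c)%:R * (b%:R * (b%:R - 1)) +
    (a + b)%:R * (2 * below_cost F a b) + c%:R * (2 * below_cost F a b) +
    (c + b)%:R * (2 * below_cost F c b) + a%:R * (2 * below_cost F c b).
  by rewrite /cell_cost !natrD; ring.
rewrite !below_cost_rec.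
have cst (n : nat) (x : F) : n%:R * x = \sum_(i < n) x.
  by rewrite sumr_const card_ord mulr_natl.
have -> : \sum_(i < a) cell_cost F i b c =
    \sum_(i < a) (2 * below_cost F i b + b%:R * (b%:R - 1)) +
    a%:R * (2 * below_cost F c b).
  by rewrite [a%:R * _]cst -big_split; apply: eq_bigr => i _ /=; rewrite /cell_cost; ring.
have -> : \sum_(k < c) cell_cost F a b k =
    \sum_(k < c) (2 * below_cost F k b + b%:R * (b%:R - 1)) +
    c%:R * (2 * below_cost F a b).
  by rewrite [c%:R * _]cst -big_split; apply: eq_bigr => k _ /=; rewrite /cell_cost; ring.
have -> : \sum_(j < b) (cell_cost F a j 0 + cell_cost F 0 j c) =
    \sum_(j < b) (2 * below_cost F a j + (j%:R * (j%:R - 1) + 2 * below_cost F 0 j)) +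
    \sum_(j < b) (2 * below_cost F c j + (j%:R * (j%:R - 1) + 2 * below_cost F 0 j)).
  by rewrite -big_split; apply: eq_bigr => j _ /=; rewrite /cell_cost; ring.
ring.
Qed.

From mathcomp Require Import all_classical all_reals all_analysis.
From mathcomp Require Import measurable_realfun.
Import numFieldNormedType.Exports.
Local Open Scope classical_set_scope.
Local Open Scope ring_scope.

Lemma sum_cell_cost (F : numFieldType) (B : nat -> F) :
  (forall m, \sum_(j < m.+1) 'C(m.+1, j)%:R * B j = (m == 0)%:R) ->
  forall n N, (0 < N)%N ->
  (\sum_(c : {ffun 'I_n -> 'I_N}) \sum_(l < N)
     cell_cost F #|finset (fun i => (c i < l)%N)| #|finset (fun i => c i == l)|
       #|finset (fun i => (l < c i)%N)|) / N%:R ^+ n =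
  \sum_(i < n) level_coef B n i.+1 / N%:R ^+ i.+1.
Proof.
move=> HB n N N0.
set lhs := (X in X / _).
have -> : lhs =
    (\sum_(c : {ffun 'I_n -> 'I_N}) \sum_(l < N)
       #|finset (fun i => c i == l)|%:R * (#|finset (fun i => c i == l)|%:R - 1)) +
    4 * (\sum_(c : {ffun 'I_n -> 'I_N}) \sum_(l < N)
       below_cost F #|finset (fun i => (c i < l)%N)| #|finset (fun i => c i == l)|).
  transitivity
   ((\sum_(c : {ffun 'I_n -> 'I_N}) \sum_(l < N)
       #|finset (fun i => c i == l)|%:R * (#|finset (fun i => c i == l)|%:R - 1)) +
    2 * (\sum_(c : {ffun 'I_n -> 'I_N}) \sum_(l < N)
       below_cost F #|finset (fun i => (c i < l)%N)| #|finset (fun i => c i == l)|) +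
    2 * (\sum_(c : {ffun 'I_n -> 'I_N}) \sum_(l < N)
       below_cost F #|finset (fun i => (l < c i)%N)| #|finset (fun i => c i == l)|)).
    rewrite !mulr_sumr -!big_split; apply: eq_bigr => c _ /=.
    by rewrite !mulr_sumr -!big_split.
  by rewrite sum_below_cost_sym; ring.
rewrite mulrDl -[4 * _ / _]mulrA (sum_below_cost HB) // sum_choose2 //.
under [RHS]eq_bigr do rewrite /level_coef mulrDl -mulrA.
rewrite big_split /=; congr (_ + _); last first.
  by rewrite mulr_sumr; apply: eq_bigr => i _; ring.
clear lhs; case: n => [|n]; first by rewrite big_ord0 !mul0r.
by rewrite big_ord_recl big1 ?addr0 => [|i _]; rewrite /= ?mul1r ?mul0r// expr1.
Qed.

(** * From the coefficients to the closed form *)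

Lemma fdiffn_harm3 (F : numFieldType) j r :
  fdiffn j.+3 (harm3 F) r =
  (-1) ^+ j / ((r + j.+3)%:R * 'C(r + j.+2, j)%:R).
Proof.
rewrite fdiffnSr (eq_fdiffn _ _ (@harm3_fdiff F)).
rewrite fdiffnSr (eq_fdiffn _ _ (@harm2_fdiff F)) fdiffn_shift.
rewrite fdiffnSr (eq_fdiffn _ _ (@harm_fdiff F)) fdiffn_invS.
rewrite (_ : (r + 2 + j).+1 = r + j.+3)%N; last by lia.
by rewrite (_ : (r + 2 + j) = r + j.+2)%N; last by lia.
Qed.

Lemma fdiffn2_harm3 (F : numFieldType) r : fdiffn 2 (harm3 F) r = harm F (r + 2)%N.
Proof.
rewrite fdiffnSr (eq_fdiffn _ _ (@harm3_fdiff F)).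
exact: (harm2_fdiff F r).
Qed.

(** Shows that [F3 n] is (n - 1) (H_(n-1) - 1). It is Newton's formula for r (H_r - 1), whose first
    difference is H_r. *)
Lemma harm_sum_alt (F : numFieldType) n :
  n%:R * (harm F n - 1) =
  \sum_(2 <= j < n.+1) (-1) ^+ j * 'C(n, j)%:R / (j%:R - 1) :> F.
Proof.
pose f r : F := r%:R * (harm F r - 1).
have f0 : f 0 = 0 by rewrite /f mul0r.
have f1 : fdiff f =1 harm F.
  move=> r; rewrite /fdiff /f {1}/harm big_ord_recr /= -/(harm F r) -natr1.
  by field; rewrite natr1 pnatr_eq0.
rewrite -/(f n) (@newton_forward0 _ f n n) // big_ord_recl.
rewrite (_ : fdiffn (@ord0 n) f 0 = 0) // mulr0 add0r.
have fS j : fdiffn j.+2 f 0 = (-1) ^+ j / j.+1%:R.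
  rewrite fdiffnSr (eq_fdiffn _ _ f1) fdiffnSr (eq_fdiffn _ _ (@harm_fdiff F)).
  by rewrite fdiffn_invS add0n binn mulr1.
rewrite big_add1 /= big_add1 /=.
case: n => [|n]; first by rewrite big_ord0 big_geq.
rewrite big_ord_recl (_ : fdiffn _ f 0 = 0); last first.
  by rewrite -[fdiffn _ _ _]/(fdiff f 0) f1 /harm big_ord0.
rewrite mulr0 add0r big_mkord; apply: eq_bigr => j _.
by rewrite !lift0 fS -[j.+2%:R]natr1 addrK exprS exprS; ring.
Qed.

Lemma fdiffn_harm3_0 (F : realFieldType) :
  (fdiffn 0 (harm3 F) 0 = 0) * (fdiffn 1 (harm3 F) 0 = 0) *
  (fdiffn 2 (harm3 F) 0 = 3 / 2) *
  (forall j, fdiffn j.+3 (harm3 F) 0 =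
    (-1) ^+ j * 2 / (j.+3%:R * (j.+3%:R - 1) * (j.+3%:R - 2))).
Proof.
split; first split; first split.
- by rewrite -[LHS]/(harm3 F 0) /harm3 big_ord0.
- by rewrite -[LHS]/(fdiff (harm3 F) 0) harm3_fdiff /harm2 big_ord0.
- by rewrite fdiffn2_harm3 add0n /harm !big_ord_recr big_ord0 /=; field.
move=> j; rewrite fdiffn_harm3 !add0n.
have -> : 'C(j.+2, j)%:R = j.+2%:R * j.+1%:R / 2 :> F.
  apply: (mulIf (_ : 2 != 0)); first by rewrite pnatr_eq0.
  rewrite divfK ?pnatr_eq0 //.
  rewrite -!natrM; congr (_%:R).
  rewrite -(@bin_sub j.+2 j); last by rewrite -addn2 leq_addr.
  rewrite (_ : (j.+2 - j = 2)%N); last by lia.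
  by rewrite -[X in (_ * X)%N]/(2`!) bin_ffact !ffactnS ffactn0 muln1.
have -> : j.+3%:R - 1 = j.+2%:R :> F by rewrite -[j.+3%:R]natr1 addrK.
have -> : j.+3%:R - 2 = j.+1%:R :> F.
  by rewrite -[j.+3%:R]natr1 -[j.+2%:R]natr1; ring.
have j0 : 0 <= j%:R :> F by rewrite ler0n.
field; rewrite -?andbA.
by repeat (apply/andP; split); apply: lt0r_neq0; lra.
Qed.

(** Source of [F1]: Newton's formula at 0 for [harm2]. The term 3 'C(n, 2) comes from the second
    difference 3/2 of [harm3] at 0. *)
Lemma harm2_sum_alt (R : realType) n : (0 < n)%N ->
  n%:R * harm2 R n.-1 = 3 * 'C(n, 2)%:R - 2 * F1 R n.
Proof.
case: n => // n _ /=.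
rewrite (@newton_forward0 _ (harm2 R) _ n) // mulr_sumr.
transitivity (\sum_(j < n.+1) j.+1%:R * 'C(n.+1, j.+1)%:R * fdiffn j.+1 (harm3 R) 0).
  apply: eq_bigr => j _; rewrite fdiffnSr (eq_fdiffn _ _ (@harm3_fdiff R)).
  by rewrite mulrA -!natrM mul_bin_diag.
rewrite /F1 big_ord_recl fdiffn_harm3_0 mulr0 add0r !big_add1.
case: n => [|n]; first by rewrite big_ord0 big_geq // bin_small // !mulr0 subr0.
rewrite big_ord_recl !lift0 fdiffn_harm3_0; congr (_ + _); first by rewrite /=; field.
rewrite big_mkord mulr_sumr -sumrN; apply: eq_bigr => j _.
rewrite !lift0 fdiffn_harm3_0.
rewrite -[j.+3%:R]natr1 -[j.+2%:R]natr1 -[j.+1%:R]natr1 !exprS.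
have j0 : 0 <= j%:R :> R by rewrite ler0n.
field; rewrite -?andbA.
by repeat (apply/andP; split); apply: lt0r_neq0; lra.
Qed.

Lemma exp2_lt1 (F : numFieldType) j : 1 - 2 ^- j.+1 != 0 :> F.
Proof.
by rewrite subr_eq0 eq_sym lt_eqF // invf_lt1 ?exprn_gt0 // exprn_egt1 ?ltr1n.
Qed.

Lemma sum_diff_at0 (R : realType) n :
  \sum_(i < n) 'C(n, i.+2)%:R * fdiffn i.+2 (harm3 R) 0 / (1 - 2 ^- i.+1) =
  3 * 'C(n, 2)%:R - 2 * F5 R n.
Proof.
rewrite /F5.
case: n => [|n]; first by rewrite big_ord0 big_geq // bin_small // !mulr0 subr0.
rewrite big_ord_recl fdiffn_harm3_0; congr (_ + _); first by rewrite /=; field.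
rewrite 3!big_add1.
case: n => [|n]; first by rewrite big_ord0 big_geq // mulr0 oppr0.
rewrite big_ord_recr bin_small // mul0r mul0r [LHS]addr0.
rewrite big_mkord mulr_sumr -sumrN; apply: eq_bigr => j _.
rewrite !lift0 fdiffn_harm3_0 3![(-1) ^+ _.+1]exprS.
have := exp2_lt1 R j.+1; set q := 1 - _ => q0.
rewrite -[j.+3%:R]natr1 -[j.+2%:R]natr1 -[j.+1%:R]natr1.
have j0 : 0 <= j%:R :> R by rewrite ler0n.
field; rewrite q0 /= -?andbA.
by repeat (apply/andP; split); apply: lt0r_neq0; lra.
Qed.

Lemma bernoulli_number012 (R : realFieldType) :
  [/\ bernoulli_number R 0 = 1, bernoulli_number R 1 = - 2^-1 &
      bernoulli_number R 2 = 6^-1].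
Proof.
have := bernoulli_sum R 2; have := bernoulli_sum R 1; have := bernoulli_sum R 0.
rewrite !big_ord_recr !big_ord0 /= !bin0 !bin1 !add0r.
rewrite (_ : 'C(3, 2) = 3)//.
move: (bernoulli_number R 0) (bernoulli_number R 1) (bernoulli_number R 2).
by move=> b0 b1 b2 e0 e1 e2; split; lra.
Qed.

(** Degree 1 is the term with [harm2]: the factors -B_1 = 1/2 and 1 / (1 - 1/2) = 2 cancel. Degree 2
    involves H_n and splits into [F3] and the term j = 2 of [F2]. From degree 3 on, each term is a
    difference of the corresponding terms of [F2] and of n times [F4]. *)
Lemma sum_bernoulli_diff (R : realType) n : (1 < n)%N ->
  \sum_(i < n) ('C(n, i.+1)%:R * bernoulli_number R i.+1 *
      ((-1) ^+ i.+1 * (fdiffn i.+1 (harm3 R) (n - i.+1)%N - fdiffn i.+1 (harm3 R) 0)))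
      / (1 - 2 ^- i.+1) =
  n%:R * harm2 R n.-1 + F2 R n + n%:R / 9 * F3 R n - n%:R * F4 R n.
Proof.
case: n => [|[|n]] // _.
have [_ B1 B2] := bernoulli_number012 R.
rewrite big_ord_recl subn1 bin1 B1.
rewrite -![fdiffn _.+1 _ _ in X in X + _]/(fdiff (harm3 R) _) !harm3_fdiff {2}/harm2 big_ord0.
rewrite -!addrA; congr (_ + _); first by rewrite /=; field.
(* In degree n the two differences are taken at the same point 0, so this term vanishes and the sums
   stop at n - 1. *)
rewrite big_ord_recr lift0 subnn subrr !mulr0 mul0r [LHS]addr0.
rewrite /F2 /F3 /F4.
case: n => [|n].
  by rewrite big_ord0 !big_geq // !mulr0 subr0 !addr0.
rewrite -harm_sum_alt [X in _ = X + _]big_ltn // B2.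
rewrite big_ord_recl.
set S2 := \sum_(3 <= j < n.+3) _; set S4 := \sum_(3 <= j < n.+3) _.
set t2 := (X in _ = X + _ + _); set h := (X in _ = _ + (X - _)).
rewrite (_ : t2 + S2 + (h - n.+3%:R * S4) = (t2 + h) + (S2 - n.+3%:R * S4)); last by ring.
congr (_ + _).
  rewrite !lift0 -[nat_of_ord (widen_ord (leqnSn n.+1) ord0)]/0%N fdiffn_harm3_0 fdiffn2_harm3.
  rewrite {}/t2 {}/h (_ : (n.+3 - 2 + 2)%N = n.+3); last by lia.
  rewrite B2 {1}/harm big_ord_recr -/(harm R n.+2).
  have -> : 'C(n.+3, 2)%:R = n.+3%:R * n.+2%:R / 2 :> R.
    apply: (mulIf (_ : 2 != 0)); first by rewrite pnatr_eq0.
    rewrite divfK ?pnatr_eq0 // -!natrM; congr (_%:R).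
    by rewrite -[X in (_ * X)%N]/(2`!) bin_ffact !ffactnS ffactn0 muln1.
  rewrite /=; have n0 : 0 <= n%:R :> R by rewrite ler0n.
  field; rewrite -?andbA.
  by repeat (apply/andP; split); apply: lt0r_neq0; lra.
rewrite {}/S2 {}/S4 !big_add1 !big_mkord mulr_sumr -sumrB.
apply: eq_bigr => j _; rewrite lift0.
rewrite (_ : nat_of_ord (widen_ord (leqnSn n.+1) (lift ord0 j)) = j.+1) //.
set b := bernoulli_number R j.+3.
have := exp2_lt1 R j.+2; set q := 1 - _ => q0.
rewrite fdiffn_harm3_0 fdiffn_harm3.
have hj : (j < n)%N := ltn_ord j.
rewrite subnK; last by lia.
rewrite (_ : (n.+3 - j.+3 + j.+2 = n.+2)%N); last by lia.
have e1 : 'C(n.+2, j.+2)%:R = j.+3%:R / n.+3%:R * 'C(n.+3, j.+3)%:R :> R.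
  apply: (mulfI (_ : n.+3%:R != 0)); first by rewrite pnatr_eq0.
  rewrite mulrA mulrCA divff ?pnatr_eq0// mulr1 -!natrM; congr (_%:R).
  by rewrite (mul_bin_diag n.+3).
(* Makes the quotient of the two binomials a rational function of [n] and [j] ([e3]), after which a
   single binomial remains and the identity is one of partial fractions. *)
have e2 : n.+3%:R * 'C(n.+2, j)%:R * ((n%:R - j%:R + 2) * (n%:R - j%:R + 1)) =
   j.+3%:R * j.+2%:R * j.+1%:R * 'C(n.+3, j.+3)%:R :> R.
  have -> : n%:R - j%:R + 2 = (n.+2 - j)%:R :> R.
    by rewrite natrB -?[n.+2%:R]natr1 -?[n.+1%:R]natr1; [ring|lia].
  have -> : n%:R - j%:R + 1 = (n.+1 - j)%:R :> R.
    by rewrite natrB -?[n.+1%:R]natr1; [ring|lia].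
  rewrite -!natrM; congr (_%:R).
  have m1 := mul_bin_diag n.+3 j.
  have m2 := mul_bin_left n.+3 j.+1.
  have m3 := mul_bin_left n.+3 j.+2.
  rewrite /= !subSS in m1 m2 m3.
  transitivity (j.+1 * 'C(n.+3, j.+1) * ((n.+2 - j) * (n.+1 - j)))%N.
    by rewrite -m1; ring.
  rewrite (_ : j.+3 * j.+2 * j.+1 * 'C(n.+3, j.+3) = j.+1 * j.+2 * (j.+3 * 'C(n.+3, j.+3)))%N; last by ring.
  rewrite m3 (_ : j.+1 * j.+2 * ((n.+1 - j) * 'C(n.+3, j.+2)) = j.+1 * (n.+1 - j) * (j.+2 * 'C(n.+3, j.+2)))%N; last by ring.
  by rewrite m2; ring.
have X0 : n.+3%:R * 'C(n.+2, j)%:R != 0 :> R.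
  by rewrite -natrM pnatr_eq0 -lt0n muln_gt0 bin_gt0 /=; lia.
have n0 : 0 <= n%:R :> R by rewrite ler0n.
have j0 : 0 <= j%:R :> R by rewrite ler0n.
have e3 : 'C(n.+3, j.+3)%:R / (n.+3%:R * 'C(n.+2, j)%:R) =
    (n%:R - j%:R + 2) * (n%:R - j%:R + 1) / (j.+3%:R * j.+2%:R * j.+1%:R) :> R.
  have J0 : j.+3%:R * j.+2%:R * j.+1%:R != 0 :> R.
    by rewrite !mulf_neq0 // pnatr_eq0.
  apply: (canLR (mulfK X0)); rewrite mulrAC; apply: (canRL (mulfK J0)).
  by rewrite mulrC -e2 mulrC.
transitivity (b / q * (2 * 'C(n.+3, j.+3)%:R / (j.+3%:R * (j.+3%:R - 1) * (j.+3%:R - 2))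
     - 'C(n.+3, j.+3)%:R / (n.+3%:R * 'C(n.+2, j)%:R))).
  have := sqrr_sign R j; rewrite expr2 => s2.
  rewrite [(-1) ^+ j.+3]exprSr [(-1) ^+ j.+2]exprSr [(-1) ^+ j.+1]exprSr.
  move: s2; set s := (-1) ^+ j => s2; set X := n.+3%:R * _; set Y := _ * _ * (_ - 2).
  transitivity (- (s * s) * (b / q * ('C(n.+3, j.+3)%:R / X - 2 * 'C(n.+3, j.+3)%:R / Y))).
    by ring.
  by rewrite s2; ring.
rewrite e3 e1.
field; rewrite q0 /= -?andbA.
by repeat (apply/andP; split); apply: lt0r_neq0; lra.
Qed.

Lemma sum_level_coef_closed_form (R : realType) n : (1 < n)%N ->
  n%:R^-1 * \sum_(i < n) level_coef (bernoulli_number R) n i.+1 / (1 - 2 ^- i.+1) =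
  2 * (n%:R - 1) - 8 / n%:R * F1 R n + 4 / n%:R * F2 R n
      + 4 / 9 * F3 R n - 4 * F4 R n + 8 / n%:R * F5 R n.
Proof.
move=> n1; have n0 : n%:R != 0 :> R by rewrite pnatr_eq0; lia.
have -> : \sum_(i < n) level_coef (bernoulli_number R) n i.+1 / (1 - 2 ^- i.+1) =
    2 * (n%:R * (n%:R - 1)) +
    4 * ((\sum_(i < n) ('C(n, i.+1)%:R * bernoulli_number R i.+1 *
      ((-1) ^+ i.+1 * (fdiffn i.+1 (harm3 R) (n - i.+1)%N - fdiffn i.+1 (harm3 R) 0)))
      / (1 - 2 ^- i.+1)) -
     \sum_(i < n) 'C(n, i.+2)%:R * fdiffn i.+2 (harm3 R) 0 / (1 - 2 ^- i.+1)).
  rewrite -sumrB mulr_sumr.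
  have -> : 2 * (n%:R * (n%:R - 1)) =
      \sum_(i < n) (i == 0 :> nat)%:R * (n%:R * (n%:R - 1)) / (1 - 2 ^- i.+1) :> R.
    case: n n1 {n0} => // n _; rewrite big_ord_recl big1 ?addr0 => [|i _].
      by rewrite /= ; field.
    by rewrite lift0 !mul0r.
  rewrite -big_split; apply: eq_bigr => i _ /=.
  by rewrite /level_coef eqSS; ring.
(* The two contributions 3 'C(n, 2), from degree 1 and from the cells' own counts, cancel here. *)
rewrite sum_bernoulli_diff // sum_diff_at0 harm2_sum_alt; last by lia.
by field.
Qed.

(** * Quickselect on a fixed list *)

(** In a list without repetitions the number of smaller elements takes each value below the size
    once: after sorting it is the index. *)
Lemma sum_count_lt (d : Order.disp_t) (T : orderType d) (V : nmodType)
    (s : seq T) (phi : nat -> V) : uniq s ->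
  \sum_(p <- s) phi (count (fun x => (x < p)%O) s) = \sum_(i < size s) phi i.
Proof.
move=> us; have sl : sorted <%O%O (sort <=%O%O s) by rewrite sort_lt_sorted.
rewrite -(perm_big _ (permEl (perm_sort <=%O%O s))) /= -(size_sort <=%O%O s).
case: (sort <=%O%O s) (perm_sort <=%O%O s) sl => [|x0 t] pst sl.
  by rewrite big_nil big_ord0.
rewrite (big_nth x0) big_mkord; apply: eq_bigr => i _.
by rewrite -(permP (introT permPl pst)) count_lt_nth.
Qed.

Lemma sum_count_gt (d : Order.disp_t) (T : orderType d) (V : nmodType)
    (s : seq T) (phi : nat -> V) : uniq s ->
  \sum_(p <- s) phi (count (fun x => (p < x)%O) s) = \sum_(i < size s) phi i.
Proof.
move=> us; have := @sum_count_lt _ (T^d) V s phi us.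
exact.
Qed.

(** The n! functions with v k < k for 0 < k <= n, and 0 at all other arguments. An explicit list
    makes the average over the pivots a finite sum, in which the pivot of the longest list is chosen
    last and can be conditioned on. *)
Fixpoint pivot_choices (n : nat) : seq (nat -> nat) :=
  if n is l.+1 then
    [seq (fun k => if k == l.+1 then j else v k) | v <- pivot_choices l, j <- iota 0 l.+1]
  else [:: fun=> 0%N].

Definition pivot_mean (R : numFieldType) (n : nat) (F : (nat -> nat) -> R) : R :=
  (n`!)%:R^-1 * \sum_(v <- pivot_choices n) F v.

Lemma pivot_meanS (R : numFieldType) (n : nat) (F : (nat -> nat) -> R) :
  pivot_mean n.+1 F =
  n.+1%:R^-1 * \sum_(j < n.+1)
    pivot_mean n (fun v => F (fun k => if k == n.+1 then j : nat else v k)).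
Proof.
rewrite /pivot_mean (_ : pivot_choices n.+1 =
  [seq (fun k => if k == n.+1 then j else v k) | v <- pivot_choices n, j <- iota 0 n.+1]) //.
rewrite big_allpairs_dep -mulr_sumr factS natrM invfM -mulrA.
rewrite [in RHS]exchange_big; congr (_ * (_ * _)); apply: eq_bigr => v _.
by rewrite -[X in iota 0 X]subn0 -/(index_iota 0 n.+1) big_mkord.
Qed.

Lemma eq_pivot_mean (R : numFieldType) (n : nat) (F G : (nat -> nat) -> R) :
  F =1 G -> pivot_mean n F = pivot_mean n G.
Proof. by move=> FG; rewrite /pivot_mean (eq_bigr G). Qed.

Lemma pivot_mean_cst (R : numFieldType) (n : nat) (x : R) :
  pivot_mean n (fun=> x) = x.
Proof.
elim: n => [|n IH]; first by rewrite /pivot_mean big_seq1 fact0 invr1 mul1r.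
rewrite pivot_meanS; under eq_bigr do rewrite IH.
by rewrite sumr_const card_ord -[X in _ * X]mulr_natl mulKf ?pnatr_eq0.
Qed.

Lemma pivot_meanD (R : numFieldType) (n : nat) (F G : (nat -> nat) -> R) :
  pivot_mean n (fun v => F v + G v) = pivot_mean n F + pivot_mean n G.
Proof. by rewrite /pivot_mean big_split mulrDr. Qed.

Lemma pivot_mean_widen (R : numFieldType) (l n : nat) (F : (nat -> nat) -> R) :
  (l <= n)%N ->
  (forall v v', (forall k, (0 < k <= l)%N -> v k = v' k) -> F v = F v') ->
  pivot_mean n F = pivot_mean l F.
Proof.
move=> ln HF; elim: n ln => [|n IH]; first by rewrite leqn0 => /eqP ->.
rewrite leq_eqVlt => /predU1P[-> //|ln].
rewrite pivot_meanS -IH //.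
under eq_bigr => j _.
  rewrite (@eq_pivot_mean _ n _ F); last first.
    by move=> v; apply: HF => k /andP[_ kl]; case: eqP => // kn; lia.
  over.
by rewrite sumr_const card_ord -[X in _ * X]mulr_natl mulKf ?pnatr_eq0.
Qed.

Lemma eq_quickselect_rec (R : realType) (v v' : nat -> nat) fuel m (s : seq R) :
  (forall k, (0 < k <= size s)%N -> v k = v' k) ->
  quickselect_rec v fuel m s = quickselect_rec v' fuel m s.
Proof.
elim: fuel m s => //= fuel IH m s vv'.
have -> : nth 0 s (v (size s)) = nth 0 s (v' (size s)).
  by case: s vv' => [|x s] vv'; [rewrite !nth_nil | rewrite vv' //= leqnn].
rewrite !IH // => k /andP[k0 ks]; apply: vv'; rewrite k0 (leq_trans ks) //;
  by rewrite size_filter count_size.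
Qed.

Definition same_cell (T : Type) (g : T -> nat) (l : nat) (c : T * T) : bool :=
  (g c.1 == l) && (g c.2 == l).

Lemma count_trichotomy (d : Order.disp_t) (T : orderType d) (s : seq T) (p : T) :
  size s = (count (fun x => x < p)%O s + count_mem p s
            + count (fun x => p < x)%O s)%N.
Proof.
elim: s => //= x s ->; rewrite -[count_mem p s]/(count_mem p s).
by case: ltgtP => /= _; lia.
Qed.

(* Summed over all ranks [m], the recursion closes up: the ranks below that of
   the pivot are exactly those of [smaller], the ranks above it those of [larger]. *)
Lemma sum_quickselect_step (R : realType) (w : R * R -> nat) (v : nat -> nat)
    (fuel : nat) (s : seq R) : uniq s -> (v (size s) < size s)%N ->
  let p := nth 0 s (v (size s)) in
  let smaller := [seq x <- s | x < p] in
  let larger := [seq x <- s | p < x] in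
  (\sum_(m < size s) \sum_(c <- quickselect_rec v fuel.+1 m.+1 s) w c =
   size s * (\sum_(x <- s | x != p) w (x, p)) +
   \sum_(m < size smaller) \sum_(c <- quickselect_rec v fuel m.+1 smaller) w c +
   \sum_(m < size larger) \sum_(c <- quickselect_rec v fuel m.+1 larger) w c)%N.
Proof.
move=> us vs p sm la; have ps : p \in s by rewrite mem_nth.
have szs : size s = (size sm + (size la).+1)%N.
  by rewrite !size_filter (count_trichotomy s p) count_uniq_mem // ps addn1 addnS addSn.
have qs m : (\sum_(c <- quickselect_rec v fuel.+1 m.+1 s) w c =
    \sum_(x <- s | x != p) w (x, p) +
    (\sum_(c <- if m == size sm then [::]
       else if (m < size sm)%N then quickselect_rec v fuel m.+1 sm
       else quickselect_rec v fuel (m - size sm) la) w c))%N.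
  rewrite [quickselect_rec _ _ _ _]/= -/p -/sm -/la big_cat; congr (_ + _)%N.
    by rewrite big_map big_filter.
  by rewrite eqSS [size sm == m]eq_sym ltnS.
under [LHS]eq_bigr do rewrite qs.
rewrite big_split /= sum_nat_const card_ord -addnA; congr (_ + _)%N.
rewrite -(big_mkord xpredT (fun m => \sum_(c <- if m == size sm then [::]
       else if (m < size sm)%N then quickselect_rec v fuel m.+1 sm
       else quickselect_rec v fuel (m - size sm) la) w c)%N).
(* The index [m] stands for rank [m.+1], so [m = size sm] is the rank of the pivot itself, where the
   recursion stops. *)
rewrite (big_cat_nat (n := size sm)) //=; last by rewrite szs leq_addr.
congr (_ + _)%N.
  rewrite big_mkord; apply: eq_bigr => m _.
  by rewrite ltn_ord ifN // neq_ltn ltn_ord.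
rewrite big_ltn; last by rewrite szs addnS ltnS leq_addr.
rewrite eqxx big_nil add0n -[(size sm).+1]add0n big_addn.
rewrite (_ : size s - (size sm).+1 = size la)%N; last by rewrite szs addnS subSS addKn.
rewrite big_mkord; apply: eq_bigr => m _.
rewrite ifN; last by rewrite neq_ltn addnS ltnS leq_addl orbT.
rewrite ifN; last by rewrite -leqNgt addnS ltnW // ltnS leq_addl.
by rewrite addnS -addSn addnK.
Qed.

(** Induction after conditioning on the pivot of [s]. The two sublists use [v] only at smaller
    lengths, so the induction hypothesis applies to each; they share these values, but only the
    linearity of the mean is needed. Monotonicity of [g] makes each cell an interval, so the three
    counts determine the result. *)
Lemma quickselect_cell_mean (R : realType) (g : R -> nat) (l fuel n : nat) (s : seq R) :
  (forall x y, x <= y -> (g x <= g y)%N) ->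
  uniq s -> (size s <= fuel)%N -> (size s <= n)%N ->
  pivot_mean n (fun v => (\sum_(m < size s)
     \sum_(c <- quickselect_rec v fuel m.+1 s) same_cell g l c)%:R) =
  cell_cost R (count (fun x => (g x < l)%N) s) (count (fun x => g x == l) s)
    (count (fun x => (l < g x)%N) s).
Proof.
move=> gh; elim: fuel n s => [|fuel IH] n s us sf sn.
  have -> : s = [::] by apply/eqP; rewrite -size_eq0 -leqn0.
  rewrite (@eq_pivot_mean _ _ _ (fun=> 0)) ?pivot_mean_cst => [|v]; last by rewrite big_ord0.
  by rewrite /= /cell_cost !below_cost_b0; ring.
(* Reduces [n] to the length of [s], so that the outermost choice in [pivot_meanS] is the pivot of
   [s] itself. *)
rewrite (@pivot_mean_widen _ (size s)) //; last first.
  move=> v v' vv'; congr (_%:R); apply: eq_bigr => m _.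
  by rewrite (eq_quickselect_rec _ _ vv').
case E : (size s) => [|k].
  have -> : s = [::] by apply/eqP; rewrite -size_eq0 E.
  rewrite (@eq_pivot_mean _ _ _ (fun=> 0)) ?pivot_mean_cst => [|v]; last by rewrite big_ord0.
  by rewrite /= /cell_cost !below_cost_b0; ring.
rewrite pivot_meanS.
pose sm p := [seq x <- s | x < p]; pose la p := [seq x <- s | p < x].
pose G t := cell_cost R (count (fun x => (g x < l)%N) t)
   (count (fun x => g x == l) t) (count (fun x => (l < g x)%N) t).
have szlt p (q : pred R) : p \in s -> (forall x, x \in s -> q x -> x != p) -> (size [seq x <- s | q x] <= k)%N.
  move=> ps qp; rewrite -ltnS -E size_filter -(count_predC q) -[X in (X < _)%N]addn0 ltn_add2l -has_count.
  by apply/hasP; exists p => //=; apply/negP => /(qp _ ps); rewrite eqxx.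
have step (j : 'I_k.+1) : pivot_mean k (fun v => (\sum_(m < k.+1)
      \sum_(c <- quickselect_rec (fun i => if i == k.+1 then j : nat else v i) fuel.+1 m.+1 s)
       same_cell g l c)%:R) =
    (fun p => k.+1%:R * (\sum_(x <- s | x != p) same_cell g l (x, p))%:R + G (sm p) + G (la p))
     (nth 0 s j).
  set p := nth 0 s j.
  have ps : p \in s by rewrite mem_nth // E.
  have smk : (size (sm p) <= k)%N.
    by apply: (szlt p) => // x _ xp; rewrite lt_eqF.
  have lak : (size (la p) <= k)%N.
    by apply: (szlt p) => // x _ xp; rewrite gt_eqF.
  have kf : (k <= fuel)%N by rewrite -ltnS -E.
  rewrite /G -(IH k (sm p)) ?filter_uniq ?(leq_trans smk kf) //.
  rewrite -(IH k (la p)) ?filter_uniq ?(leq_trans lak kf) //.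
  rewrite -[X in X + _ + _](pivot_mean_cst k) -!pivot_meanD.
  apply: eq_pivot_mean => v; rewrite -natrM -!natrD; congr (_%:R).
  have := @sum_quickselect_step R (same_cell g l) (fun i => if i == k.+1 then j : nat else v i) fuel s us.
  rewrite E eqxx ltn_ord => /(_ isT) /= ->; rewrite -/p -/(sm p) -/(la p).
  congr (_ + _ + _)%N; apply: eq_bigr => m _.
    rewrite (@eq_quickselect_rec _ _ v) // => i /andP[_ /leq_trans/(_ smk) ik].
    by rewrite ltn_eqF.
  rewrite (@eq_quickselect_rec _ _ v) // => i /andP[_ /leq_trans/(_ lak) ik].
  by rewrite ltn_eqF.
under eq_bigr do rewrite step.
pose T p := k.+1%:R * (\sum_(x <- s | x != p) same_cell g l (x, p))%:R + G (sm p) + G (la p).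
rewrite -(big_mkord xpredT (fun j => T (nth 0 s j))) -[X in index_iota 0 X]E -(big_nth 0 xpredT).
have glt x p : (g x < g p)%N -> x < p.
  by move=> gxp; rewrite ltNge; apply/negP => /gh; rewrite leqNgt gxp.
set A := count (fun x => (g x < l)%N) s; set B := count (fun x => g x == l) s.
set C := count (fun x => (l < g x)%N) s.
have cE (P Q : pred R) : count P [seq x <- s | Q x] = count Q [seq x <- s | P x].
  by rewrite !count_filter; apply: eq_count => x /=; rewrite andbC.
have c0 (P Q : pred R) : (forall x, P x -> ~~ Q x) -> count P [seq x <- s | Q x] = 0%N.
  move=> PQ; rewrite count_filter (eq_count (a2 := xpred0)) ?count_pred0 // => x /=.
  by apply/negP => /andP[/PQ/negP].
have cT (P Q : pred R) : (forall x, P x -> Q x) -> count P [seq x <- s | Q x] = count P s.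
  move=> PQ; rewrite count_filter; apply: eq_count => x /=.
  by case: (boolP (P x)) => //= /PQ ->.
(* [TL], [TI] and [TC] treat pivots left of, in and right of the cell. In [TL] all keys of the cell
   lie in the list of larger keys, and the list of smaller keys contributes 0. *)
have TL p : (g p < l)%N ->
    T p = cell_cost R (count (fun x => p < x) [seq x <- s | (g x < l)%N]) B C.
  move=> gp; rewrite /T big1 ?mulr0 ?add0r => [|x _]; last first.
    by rewrite /same_cell /= (ltn_eqF gp) andbF.
  rewrite /G /sm [count (fun x => g x == l) _]c0 => [|x /eqP gx]; last first.
    by rewrite -leNgt ltW // glt // gx.
  rewrite [count (fun x => (l < g x)%N) _]c0 => [|x gx]; last first.
    by rewrite -leNgt ltW // glt // (ltn_trans gp).
  rewrite {1}/cell_cost !below_cost_b0 mul0r !mulr0 !add0r.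
  rewrite /la [count (fun x => (g x < l)%N) _]cE.
  rewrite [count (fun x => g x == l) _]cT => [|x /eqP gx]; last by rewrite glt // gx.
  rewrite [count (fun x => (l < g x)%N) _]cT // => x gx.
  by rewrite glt // (ltn_trans gp).
have TC p : (l < g p)%N ->
    T p = cell_cost R A B (count (fun x => x < p) [seq x <- s | (l < g x)%N]).
  move=> gp; rewrite /T big1 ?mulr0 ?add0r => [|x _]; last first.
    by rewrite /same_cell /= (gtn_eqF gp) andbF.
  rewrite addrC /G /la [count (fun x => g x == l) _]c0 => [|x /eqP gx]; last first.
    by rewrite -leNgt ltW // glt // gx.
  rewrite [count (fun x => (g x < l)%N) _]c0 => [|x gx]; last first.
    by rewrite -leNgt ltW // glt // (ltn_trans gx).
  rewrite {1}/cell_cost !below_cost_b0 mul0r !mulr0 !add0r.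
  rewrite /sm [count (fun x => (l < g x)%N) _]cE.
  rewrite [count (fun x => g x == l) _]cT => [|x /eqP gx]; last by rewrite glt // gx.
  rewrite [count (fun x => (g x < l)%N) _]cT // => x gx.
  by rewrite glt // (ltn_trans gx).
have TI p : p \in s -> (g p == l) -> T p = k.+1%:R * (B%:R - 1) +
    cell_cost R A (count (fun x => x < p) [seq x <- s | g x == l]) 0 +
    cell_cost R 0 (count (fun x => p < x) [seq x <- s | g x == l]) C.
  move=> ps gp; rewrite /T; congr (_ + _ + _).
  - congr (_ * _).
    have -> : B = (\sum_(x <- s | x != p) same_cell g l (x, p)).+1.
      rewrite /B -sum1_count big_mkcond (bigD1_seq p) //= gp add1n; congr _.+1.
      by apply: eq_bigr => x _; rewrite /same_cell /= gp andbT; case: eqP.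
    by rewrite -natr1 addrK.
  - rewrite /G /sm [count (fun x => (l < g x)%N) _]c0 => [|x gx]; last first.
      by rewrite -leNgt ltW // glt // (eqP gp).
    rewrite [count (fun x => (g x < l)%N) _]cT ?[count (fun x => g x == l) _]cE // => x gx.
    by rewrite glt // (eqP gp).
  - rewrite /G /la [count (fun x => (g x < l)%N) _]c0 => [|x gx]; last first.
      by rewrite -leNgt ltW // glt // (eqP gp).
    rewrite [count (fun x => (l < g x)%N) _]cT ?[count (fun x => g x == l) _]cE // => x gx.
    by rewrite glt // (eqP gp).
have szE : k.+1 = (A + B + C)%N.
  rewrite -E /A /B /C; elim: (s) => //= x t ->.
  by case: (ltngtP (g x) l) => _ /=; lia.
have -> : \sum_(p <- s) T p =
  \sum_(p <- [seq x <- s | (g x < l)%N]) T p + \sum_(p <- [seq x <- s | g x == l]) T p +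
  \sum_(p <- [seq x <- s | (l < g x)%N]) T p.
  rewrite !big_filter (bigID (fun p => (g p < l)%N)) /= -addrA; congr (_ + _).
  rewrite (bigID (fun p => g p == l)) /=; congr (_ + _); apply: eq_bigl => x.
    by case: ltngtP.
  by case: ltngtP.
apply: (mulfI (_ : k.+1%:R != 0)); first by rewrite pnatr_eq0.
rewrite mulVKf ?pnatr_eq0 // szE cell_cost_rec.
(* Within each class of pivots, the number of class members on one side of the pivot takes each
   value once, which turns the sums over pivots into those of [cell_cost_rec]. *)
rewrite (eq_big_seq (fun p => cell_cost R (count (fun x => p < x) [seq x <- s | (g x < l)%N]) B C)); last first.
  by move=> p; rewrite mem_filter => /andP[gp _]; rewrite TL.
rewrite (sum_count_gt (fun i => cell_cost R i B C)) ?filter_uniq // size_filter -/A.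
rewrite [X in _ + X](eq_big_seq (fun p => cell_cost R A B (count (fun x => x < p) [seq x <- s | (l < g x)%N]))); last first.
  by move=> p; rewrite mem_filter => /andP[gp _]; rewrite TC.
rewrite (sum_count_lt (fun i => cell_cost R A B i)) ?filter_uniq // size_filter -/C.
congr (_ + _).
rewrite addrC [RHS]addrAC; congr (_ + _).
rewrite (eq_big_seq (fun p => k.+1%:R * (B%:R - 1) +
    cell_cost R A (count (fun x => x < p) [seq x <- s | g x == l]) 0 +
    cell_cost R 0 (count (fun x => p < x) [seq x <- s | g x == l]) C)); last first.
  by move=> p; rewrite mem_filter => /andP[gp ps]; rewrite TI.
transitivity (\sum_(p <- [seq x <- s | g x == l]) k.+1%:R * (B%:R - 1) +
   (\sum_(j < B) cell_cost R A j 0 + \sum_(j < B) cell_cost R 0 j C)).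
  have := sum_count_gt (fun i => cell_cost R 0 i C) (filter_uniq (fun x => g x == l) us).
  have := sum_count_lt (fun i => cell_cost R A i 0) (filter_uniq (fun x => g x == l) us).
  rewrite size_filter -/B => <- <-.
  by rewrite -!big_split; apply: eq_bigr => p _; rewrite -addrA.
rewrite -big_split; congr (_ + _).
by rewrite big_const_seq count_predT size_filter -/B iter_addr_0 -[LHS]mulr_natl szE; ring.
Qed.

(** * Dyadic cells *)

Definition cell (R : realType) (k : nat) (x : R) : nat := Num.truncn (2 ^+ k * x).

Lemma cell_mono (R : realType) k (x y : R) : x <= y -> (cell k x <= cell k y)%N.
Proof. by move=> xy; apply: Num.Theory.le_truncn; rewrite ler_pM2l ?exprn_gt0. Qed.

Lemma cell0 (R : realType) (x : R) : 0 <= x < 1 -> cell 0 x = 0%N.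
Proof.
move=> /andP[x0 x1]; rewrite /cell expr0 mul1r.
by apply/eqP; rewrite Num.Theory.truncn_eq ?x0//.
Qed.

Lemma cell_itv (R : realType) k (x : R) : 0 <= x ->
  (cell k x)%:R <= 2 ^+ k * x < (cell k x).+1%:R.
Proof. by move=> x0; apply: Num.Theory.truncn_itv; rewrite mulr_ge0 ?exprn_ge0. Qed.

Lemma cell_lt (R : realType) k (x : R) : 0 <= x < 1 -> (cell k x < 2 ^ k)%N.
Proof.
move=> /andP[x0 x1]; rewrite Num.Theory.truncn_lt_nat ?mulr_ge0 ?exprn_ge0 //.
by rewrite natrX -[ltRHS]mulr1 ltr_pM2l ?exprn_gt0.
Qed.

Lemma cell_half (R : realType) k (x : R) : 0 <= x -> cell k x = (cell k.+1 x)./2.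
Proof.
move=> x0; apply: Num.Theory.truncn_def; have := cell_itv k.+1 x0.
rewrite exprS -mulrA; set z := 2 ^+ k * x; set c := cell _ _.
rewrite -[c.+1%:R]natr1 -[(c./2).+1%:R]natr1.
have -> : c%:R = (odd c)%:R + 2 * (c./2)%:R :> R.
  by rewrite -natrM -natrD mul2n odd_double_half.
move: (c./2)%:R => h /andP[].
by case: (odd c) => /= le_c lt_c; apply/andP; split; lra.
Qed.

Lemma cellS (R : realType) k (x : R) : 0 <= x ->
  cell k.+1 x = (bit x k.+1 + (cell k x).*2)%N.
Proof. by move=> x0; rewrite (cell_half k x0) odd_double_half. Qed.

Lemma cell_eq_le (R : realType) j k (x y : R) : 0 <= x -> 0 <= y -> (j <= k)%N ->
  cell k x = cell k y -> cell j x = cell j y.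
Proof.
move=> x0 y0; elim: k => [|k IH]; first by rewrite leqn0 => /eqP ->.
rewrite leq_eqVlt => /predU1P[-> //|jk] e; apply: IH => //.
by rewrite (cell_half k x0) (cell_half k y0) e.
Qed.

(** Once 2^k |x - y| >= 1, the numbers 2^k x and 2^k y cannot have the same integer part. *)
Lemma exists_cell_neq (R : realType) (x y : R) : 0 <= x -> 0 <= y -> x != y ->
  exists k, cell k x != cell k y.
Proof.
move=> x0 y0 xy; pose e := `|x - y|; have e0 : 0 < e by rewrite normr_gt0 subr_eq0.
pose k := (Num.truncn e^-1).+1; exists k; apply/negP => /eqP ckxy.
have ek : 1 <= 2 ^+ k * e.
  rewrite -[leLHS](mulVf (lt0r_neq0 e0)) ler_pM2r //.
  have : 0 <= e^-1 by rewrite invr_ge0 ltW.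
  move/Num.Theory.truncn_itv => /andP[_ /ltW h]; apply: le_trans h _.
  by rewrite -natrX ler_nat ltnW // ltn_expl.
have := cell_itv k x0; have := cell_itv k y0; rewrite ckxy -natr1.
move: ek; rewrite /e -{1}[2 ^+ k]gtr0_norm ?exprn_gt0 // -normrM mulrBr ler_normr.
by set a := 2 ^+ k * x; set b := 2 ^+ k * y; set c := _%:R => /orP[] ab /andP[b1 b2] /andP[a1 a2]; lra.
Qed.

(** Two keys share their cell at level [k] exactly when their first [k] bits agree, that is for k =
    0, ..., beta - 1. *)
Lemma sum_cell_eq (R : realType) (x y : R) M : 0 <= x < 1 -> 0 <= y < 1 -> x != y ->
  (beta x y <= M)%N -> (\sum_(k < M) (cell k x == cell k y) = beta x y)%N.
Proof.
move=> x01 y01 xy; have [x0 _] := andP x01; have [y0 _] := andP y01.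
have agree k : (forall j, (0 < j <= k)%N -> bit x j = bit y j) -> cell k x = cell k y.
  elim: k => [|k IH] h; first by rewrite !cell0.
  rewrite !cellS // h ?ltnSn // IH // => j /andP[j0 jk]; apply: h.
  by rewrite j0 leqW.
rewrite /beta; case: pselect => [ex|nex]; last first.
  have [k /eqP[]] := exists_cell_neq x0 y0 xy; apply: agree => j /andP[j0 _].
  by apply/eqP/negP => /negP bj; apply: nex; exists j; rewrite j0.
case: ex_minnP => b /andP[b0 bb] bmin bM.
have celleq k : (cell k x == cell k y) = (k < b)%N.
  apply/eqP/idP => [e|kb]; last first.
    apply: agree => j /andP[j0 jk]; apply/eqP/negP => /negP bj.
    by have := bmin j; rewrite j0 bj => /(_ isT); lia.
  rewrite ltnNge; apply/negP => bk; move/eqP: bb; apply.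
  by have := cell_eq_le x0 y0 bk e; rewrite /bit -!/(cell _ _) => ->.
under eq_bigr do rewrite celleq.
rewrite -[RHS]card_ord -sum1_card (big_ord_widen M (fun=> 1%N)) // [RHS]big_mkcond.
by apply: eq_bigr => k _; case: ltnP.
Qed.

Lemma cell_eq_sum (R : realType) k (x y : R) : 0 <= x < 1 ->
  ((cell k x == cell k y) = \sum_(l < 2 ^ k) same_cell (cell k) l (x, y) :> nat)%N.
Proof.
move=> x01; rewrite (bigD1 (Ordinal (cell_lt k x01))) //= big1 => [|l lx].
  by rewrite /same_cell /= eqxx addn0 eq_sym.
by rewrite /same_cell /= -[cell k x == l]/(Ordinal (cell_lt k x01) == l :> nat) val_eqE eq_sym (negbTE lx).
Qed.

Lemma mem_quickselect_rec (R : realType) (v : nat -> nat) fuel m (s : seq R) c :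
  (forall l, (0 < l <= size s)%N -> (v l < l)%N) ->
  c \in quickselect_rec v fuel m s -> [/\ c.1 \in s, c.2 \in s & c.1 != c.2].
Proof.
elim: fuel m s => //= fuel IH m s vs; rewrite mem_cat => /orP[/mapP[x]|].
  rewrite mem_filter => /andP[xp xs] -> /=; split => //.
  by rewrite mem_nth // vs // leqnn andbT; case: (s) xs.
have sub q m' : c \in quickselect_rec v fuel m' [seq x <- s | q x] ->
    [/\ c.1 \in s, c.2 \in s & c.1 != c.2].
  move/IH => [l /andP[l0 ls]|]; first by rewrite vs // l0 (leq_trans ls) // size_filter count_size.
  by rewrite !mem_filter => /andP[_ c1] /andP[_ c2] c12.
by case: ifP => // _; case: ifP => _; apply: sub.
Qed.

Definition level_cost (R : realType) (k : nat) (v : nat -> nat) (m : nat) (s : seq R) : nat :=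
  (\sum_(c <- quickselect v m s) (cell k c.1 == cell k c.2))%N.

Lemma bit_comparisons_series (R : realType) (v : nat -> nat) m (s : seq R) :
  (forall l, (0 < l <= size s)%N -> (v l < l)%N) ->
  (forall x, x \in s -> 0 <= x < 1) ->
  (\sum_(0 <= k <oo) (level_cost k v m s)%:R%:E
   = (bit_comparisons v m s)%:R%:E :> \bar R)%E.
Proof.
move=> vs s01; apply: cvg_lim => //.
(* The total cost bounds every single [beta], so the partial sums are constant from this index
   on. *)
apply: cvg_near_cst; exists (bit_comparisons v m s) => // M /= leM.
rewrite sumEFin -natr_sum big_mkord; congr (_%:R%:E).
rewrite exchange_big /= /bit_comparisons; apply: eq_big_seq => c cs.
have [c1 c2 c12] := mem_quickselect_rec vs cs.
apply: sum_cell_eq; rewrite ?s01 //.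
by apply: leq_trans leM; rewrite /bit_comparisons (big_rem c) //= leq_addr.
Qed.

(** * Independence and expectation *)

Section integral_off_null.
Import HBNNSimple.

(* Neither function is assumed measurable: a nonnegative simple function below
   [f] becomes one below [g] when it is cut off on the null set. *)
Lemma ge0_le_integral_off_null d (T : measurableType d) (R : realType)
    (mu : {measure set T -> \bar R}) (N : set T) (f g : T -> \bar R) :
  measurable N -> mu N = 0%E ->
  (forall x, (0 <= f x)%E) -> (forall x, (0 <= g x)%E) ->
  (forall x, ~ N x -> (f x <= g x)%E) ->
  (\int[mu]_x f x <= \int[mu]_x g x)%E.
Proof.
move=> mN N0 f0 g0 fg; rewrite !ge0_integralTE //.
apply: ge_ereal_sup => /= _ [h hf <-].
apply: ereal_sup_ubound => /=.
exists (proj_nnsfun h (measurableC mN)).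
  move=> x; rewrite -mrestrict /patch; case: ifPn => [|_]; last exact: g0.
  by rewrite inE => Nx; apply: (le_trans (hf x)); apply: fg.
have sE (k : {nnsfun T >-> R}) : sintegral mu k = (\int[mu]_x (k x)%:E)%E.
  by rewrite integral_nnsfun // patch_setT.
rewrite !sE; apply: ge0_ae_eq_integral => //.
- exact/measurable_EFinP.
- exact/measurable_EFinP.
- by move=> x _; rewrite lee_fin.
- by move=> x _; rewrite lee_fin.
- exists N; split => // x; apply: contra_notP => Nx _; congr _%:E.
  by rewrite -mrestrict /patch ifT // inE.
Qed.

Lemma eq_integral_off_null d (T : measurableType d) (R : realType)
    (mu : {measure set T -> \bar R}) (N : set T) (f g : T -> \bar R) :
  measurable N -> mu N = 0%E ->
  (forall x, (0 <= f x)%E) -> (forall x, (0 <= g x)%E) ->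
  (forall x, ~ N x -> f x = g x) ->
  (\int[mu]_x f x = \int[mu]_x g x)%E.
Proof.
move=> mN N0 f0 g0 fg; apply/eqP; rewrite eq_le.
by rewrite !(ge0_le_integral_off_null mN N0) // => x /fg ->.
Qed.

End integral_off_null.

(** A family closed under intersection that generates the joint sigma-algebra of the keys; on it,
    independence is just the product formula. *)
Definition key_rectangles (R : realType) d (T : measurableType d)
    (P : probability T R) (n : nat) (U : 'I_n -> {RV P >-> R}) : set (set T) :=
  [set E | exists2 A : 'I_n -> set R, (forall i, measurable (A i)) &
     E = [set w | forall i, A i (U i w)]].

Definition pivot_event (R : realType) d (T : measurableType d)
    (P : probability T R) (n : nat) (V : nat -> {RV P >-> nat}) (v : nat -> nat) : set T :=
  [set w | forall l : 'I_n, V l.+1 w = v l.+1].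

Lemma measurable_key_rectangles (R : realType) d (T : measurableType d)
    (P : probability T R) (n : nat) (U : 'I_n -> {RV P >-> R}) :
  key_rectangles U `<=` measurable.
Proof.
move=> _ [A mA ->].
have -> : [set w | forall i, A i (U i w)] = \bigcap_(i in [set: 'I_n]) (U i @^-1` A i).
  by apply/seteqP; split => w /= h i => [_|]; apply: h.
apply: fin_bigcap_measurable => // i _.
rewrite -[_ @^-1` _]setTI; exact: measurable_funPT.
Qed.

Lemma setI_closed_key_rectangles (R : realType) d (T : measurableType d)
    (P : probability T R) (n : nat) (U : 'I_n -> {RV P >-> R}) :
  setI_closed (key_rectangles U).
Proof.
move=> _ _ [A mA ->] [B mB ->]; exists (fun i => A i `&` B i).
  by move=> i; apply: measurableI.
apply/seteqP; split => w /=; first by move=> [Aw Bw] i; split; [apply: Aw|apply: Bw].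
by move=> ABw; split => i; have [] := ABw i.
Qed.

Lemma measurable_pivot_event (R : realType) d (T : measurableType d)
    (P : probability T R) (n : nat) (V : nat -> {RV P >-> nat}) (v : nat -> nat) :
  measurable (pivot_event n V v).
Proof.
have -> : pivot_event n V v =
    \bigcap_(l in [set: 'I_n]) (V l.+1 @^-1` [set v l.+1]).
  by apply/seteqP; split => w /= h i => [_|]; apply: h.
apply: fin_bigcap_measurable => // i _.
rewrite -[_ @^-1` _]setTI; exact: measurable_funPT.
Qed.

Section independence.
Context (R : realType) d (T : measurableType d) (P : probability T R) (n : nat).
Context (U : 'I_n -> {RV P >-> R}) (V : nat -> {RV P >-> nat}).
Context (UV : mutually_independent P (key_pivot_events U V)).
Implicit Types (A : 'I_n -> set R) (v : nat -> nat).

Let event A v (i : 'I_n + 'I_n) : set T :=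
  match i with inl a => U a @^-1` A a | inr l => V l.+1 @^-1` [set v l.+1] end.

Let eventP A v : (forall i, measurable (A i)) ->
  forall i, key_pivot_events U V i (event A v i).
Proof.
move=> mA [i|l] /=; first by exists (A i); rewrite ?setTI.
by exists [set v l.+1]; rewrite ?setTI.
Qed.

Lemma key_rectangle_prob A : (forall i, measurable (A i)) ->
  P [set w | forall i, A i (U i w)] = (\prod_i P (U i @^-1` A i))%E.
Proof.
move=> mA; have := UV (J := finset (fun i : 'I_n + 'I_n => if i is inl _ then true else false))
   (fun i _ => eventP (fun=> 0%N) mA i).
rewrite big_sumType /= [X in (_ * X)%E]big1 ?mule1 => [e|i]; last by rewrite inE.
transitivity (P (\bigcap_(i in [set` finset (fun i : 'I_n + 'I_n => if i is inl _ then true else false)])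
     event A (fun=> 0%N) i)).
  congr (P _); apply/seteqP; split => w /= h.
    by move=> [i|i]; rewrite /= inE //= => _; apply: h.
  by move=> i; apply: (h (inl i)); rewrite /= inE.
by rewrite e; apply: eq_bigl => i; rewrite inE.
Qed.

Lemma key_pivot_rectangle_prob A v : (forall i, measurable (A i)) ->
  P ([set w | forall i, A i (U i w)] `&` pivot_event n V v) =
  ((\prod_i P (U i @^-1` A i)) * \prod_(l < n) P (V l.+1 @^-1` [set v l.+1]))%E.
Proof.
move=> mA; have := UV (J := finset.setT) (fun i _ => eventP v mA i).
rewrite big_sumType /= => e.
transitivity (P (\bigcap_(i in [set` (finset.setT : {set 'I_n + 'I_n})]) event A v i)).
  congr (P _); apply/seteqP; split => w /= h.
    by case: h => hA hv [i|i] _; [apply: hA|apply: hv].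
  split => i; first by apply: (h (inl i)); rewrite /= inE.
  by apply: (h (inr i)); rewrite /= inE.
by rewrite e; congr (_ * _)%E; apply: eq_bigl => i; rewrite inE.
Qed.

Lemma pivot_event_prob v :
  P (pivot_event n V v) = (\prod_(l < n) P (V l.+1 @^-1` [set v l.+1]))%E.
Proof.
have := @key_pivot_rectangle_prob (fun=> setT) v (fun=> measurableT).
rewrite [X in (X * _)%E]big1 ?mul1e => [<-|i _]; last by rewrite preimage_setT probability_setT.
by congr (P _); apply/seteqP; split => // w [].
Qed.

(** For a fixed pivot event B, the finite measures P (E [&] B) and P E * P B agree on the
    rectangles, hence on the sigma-algebra they generate. *)
Lemma key_pivot_indep v E : <<s key_rectangles U >> E ->
  P (E `&` pivot_event n V v) = (P E * P (pivot_event n V v))%E.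
Proof.
have mB := @measurable_pivot_event R d T P n V v.
have PB : P (pivot_event n V v) \is a fin_num by apply: fin_num_measure.
pose r : {nonneg R} := NngNum (fine_ge0 (measure_ge0 P (pivot_event n V v))).
have GT : key_rectangles U setT.
  by exists (fun=> setT) => //; apply/seteqP; split.
have := @g_sigma_algebra_measure_unique _ R T _ (@measurable_key_rectangles _ _ _ _ _ U)
  (fun=> setT) (fun=> GT) _ (mrestr P mB) (mscale r P)
  (@setI_closed_key_rectangles _ _ _ _ _ U).
move=> /= H sE; have := H _ _ _ E sE.
rewrite /mrestr /mscale /= fineK // muleC; apply.
- by rewrite bigcup_const //; exists 0%N.
- by move=> _ [A mA ->]; rewrite key_pivot_rectangle_prob // -key_rectangle_prob // pivot_event_prob muleC.
- by move=> _; rewrite setTI ltey_eq PB.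
Qed.

Let GT := g_sigma_algebraType (key_rectangles U).

Lemma measurable_key_sigma (i : 'I_n) : measurable_fun [set: GT] (U i : GT -> R).
Proof.
move=> _ B mB; rewrite setTI; apply: sub_sigma_algebra.
exists (fun j => if j == i then B else setT); first by move=> j; case: ifP.
apply/seteqP; split => w /= h; last by have := h i; rewrite eqxx.
by move=> j; case: eqP => [->|].
Qed.

Lemma cell_measurable k : measurable_fun [set: R] (fun x : R => (cell k x)%:R : R).
Proof.
apply: nondecreasing_measurable => //= x y xy.
by rewrite ler_nat cell_mono.
Qed.

End independence.

(** * Uniform keys in dyadic cells; ties and keys outside the unit interval *)

Lemma uniform_prob_itv (R : realType) (a b : R) : 0 <= a -> a < b -> b <= 1 ->
  uniform_prob (ltr01 : 0 < 1 :> R) `[a, b[ = (b - a)%:E.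
Proof.
move=> a0 ab b1; rewrite /uniform_prob.
rewrite (eq_integral (fun=> 1%:E)); last first.
  move=> x; rewrite inE /= in_itv /= => /andP[ax xb].
  by rewrite /uniform_pdf (le_trans a0 ax) (le_trans (ltW xb) b1) /= subr0 invr1.
by rewrite integral_cst //= mul1e lebesgue_measure_itv /= lte_fin ab EFinB.
Qed.

Definition cell_itv_set (R : realType) (k l : nat) : set R :=
  `[l%:R / 2 ^+ k, l.+1%:R / 2 ^+ k[.

(** For x < 0 truncation yields cell 0, although x lies in none of these intervals. *)
Lemma cell_itvP (R : realType) k l (x : R) : 0 <= x ->
  cell_itv_set k l x <-> cell k x = l.
Proof.
move=> x0; rewrite /cell_itv_set /= in_itv /= ler_pdivrMr ?exprn_gt0 //.
rewrite ltr_pdivlMr ?exprn_gt0 // [x * _]mulrC; split => [|<-].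
  exact: Num.Theory.truncn_def.
exact: cell_itv.
Qed.

Section keys.
Context (R : realType) d (T : measurableType d) (P : probability T R) (n : nat).
Context (U : 'I_n -> {RV P >-> R}) (V : nat -> {RV P >-> nat}).
Context (U_uniform : forall (i : 'I_n) (A : set R), measurable A ->
       distribution P (U i) A = uniform_prob (ltr01 : 0 < 1 :> R) A).
Context (UV : mutually_independent P (key_pivot_events U V)).

Lemma key_cell_prob i k l : (l < 2 ^ k)%N ->
  P (U i @^-1` cell_itv_set k l) = (2 ^- k)%:E.
Proof.
move=> lk; have := U_uniform i (A := cell_itv_set k l).
rewrite /distribution /pushforward => ->; last exact: measurable_itv.
rewrite uniform_prob_itv.
- by rewrite -mulrBl -natr1 addrAC subrr add0r mul1r.
- by rewrite divr_ge0 ?exprn_ge0.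
- by rewrite ltr_pM2r ?invr_gt0 ?exprn_gt0 // ltr_nat.
- by rewrite ler_pdivrMr ?exprn_gt0 // mul1r -natrX ler_nat.
Qed.

Lemma keys_cells_prob k (c : {ffun 'I_n -> 'I_(2 ^ k)}) :
  P [set w | forall i, cell_itv_set k (c i) (U i w)] = ((2 ^+ k) ^- n)%:E.
Proof.
rewrite (key_rectangle_prob UV (A := fun i => cell_itv_set k (c i))); last first.
  by move=> i; exact: measurable_itv.
under eq_bigr do rewrite key_cell_prob //.
by rewrite prodEFin prodr_const card_ord exprVn.
Qed.

Definition good_keys : set T :=
  [set w | (forall i, 0 <= U i w < 1) /\ (forall i j, i != j -> U i w != U j w)].

Let GT := g_sigma_algebraType (key_rectangles U).

Let sigma_bool (b : T -> bool) : measurable_fun [set: GT] (b : GT -> bool) ->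
  @measurable _ GT [set w | b w].
Proof. by move=> /(_ measurableT [set true] I); rewrite setTI. Qed.

Lemma sigma_good_keys : <<s key_rectangles U >> good_keys.
Proof.
have -> : good_keys =
   (\bigcap_(i in [set: 'I_n]) ([set w | 0 <= U i w] `&` [set w | U i w < 1])) `&`
   (\bigcap_(p in [set: 'I_n * 'I_n]) (if p.1 == p.2 then setT
      else ~` [set w | U p.1 w == U p.2 w])).
  apply/seteqP; split => w [h1 h2]; split.
  - by move=> i _; have /andP[] := h1 i.
  - by move=> [i j] _ /=; case: eqP => // /eqP ij; apply/negP; apply: h2.
  - by move=> i; have [h3 h4] := h1 i I; apply/andP.
  - move=> i j ij; have := h2 (i, j) I; rewrite /= (negbTE ij) => h.
    exact/negP.
have mU := @measurable_key_sigma R d T P n U.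
apply: (@measurableI _ GT); apply: (@fin_bigcap_measurable _ GT) => //.
  move=> i _; apply: (@measurableI _ GT); apply: sigma_bool.
    by apply: measurable_fun_ler => //; exact: mU.
  by apply: measurable_fun_ltr => //; exact: mU.
move=> [i j] _ /=; case: ifP => _; first exact: (@measurableT _ GT).
apply: (@measurableC _ GT); apply: sigma_bool.
by apply: measurable_fun_eqr; exact: mU.
Qed.

Lemma sigma_measurable E : <<s key_rectangles U >> E -> measurable E.
Proof.
exact: (smallest_sub (@sigma_algebra_measurable _ T) (@measurable_key_rectangles _ _ _ _ _ U)).
Qed.

(** Tied keys in [0, 1) share one of the 2^k cells, and independence gives each cell probability
    4^-k. Hence the tie has probability at most 2^-k for every [k]; no joint density is involved. *)
Lemma tie_negligible i j : i != j ->
  P.-negligible [set w | (0 <= U i w < 1) && (U i w == U j w)].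
Proof.
move=> ij.
have mA : measurable [set w | (0 <= U i w < 1) && (U i w == U j w)].
  rewrite (_ : [set w | _] = [set w | 0 <= U i w] `&` [set w | U i w < 1] `&` [set w | U i w == U j w]).
    have mU := @measurable_key_sigma R d T P n U.
    apply: sigma_measurable; apply: (@measurableI _ GT); first apply: (@measurableI _ GT).
    - by apply: sigma_bool; apply: measurable_fun_ler => //; exact: mU.
    - by apply: sigma_bool; apply: measurable_fun_ltr => //; exact: mU.
    - by apply: sigma_bool; apply: measurable_fun_eqr => //; exact: mU.
  by apply/seteqP; split => w /=; [move=> /andP[/andP[]]|move=> [[-> ->] ->]].
have bound k : (P [set w | ((0 <= U i w < 1) && (U i w == U j w))%R] <= (2 ^- k)%:E)%E.
  pose B (l : nat) (i' : 'I_n) : set R :=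
    if (i' == i) || (i' == j) then cell_itv_set k l else setT.
  have mB l i' : measurable (B l i').
    by rewrite /B; case: (_ || _); [exact: measurable_itv|exact: measurableT].
  pose A l := [set w | forall i', B l i' (U i' w)].
  have PA (l : 'I_(2 ^ k)) : P (A l) = (2 ^- k * 2 ^- k)%:E.
    rewrite (key_rectangle_prob UV (mB l)) (bigD1 i) // (bigD1 j) 1?eq_sym // /B.
    rewrite !eqxx orbT /= big1 => [|i' /andP[/negbTE -> /negbTE ->]].
      by rewrite mule1 !key_cell_prob.
    by rewrite preimage_setT probability_setT.
  apply: (@le_trans _ _ (\sum_(l < 2 ^ k) P (A l))%E).
    apply: content_subadditive => //.
      by move=> l _; apply: measurable_key_rectangles; exists (B l).
    move=> w /= /andP[w01 /eqP wij]; rewrite -bigcup_mkord.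
    exists (cell k (U i w)); first exact: cell_lt.
    move=> i'; rewrite /B.
    have h : cell_itv_set k (cell k (U i w)) (U i w).
      by apply/cell_itvP => //; case/andP: w01.
    by case: eqP => [->//|_]; case: eqP => [->|] //=; rewrite -wij.
  under eq_bigr do rewrite PA.
  rewrite sumEFin lee_fin sumr_const card_ord -[X in X <= _]mulr_natl natrX mulrA.
  by rewrite mulfV ?mul1r // expf_neq0.
apply/negligibleP; first exact: mA.
apply/eqP; rewrite eq_le measure_ge0 andbT.
apply/lee_addgt0Pr => e e0; rewrite add0e.
pose k := (Num.truncn e^-1).+1; apply: (le_trans (bound k)).
rewrite lee_fin -[leRHS]invrK lef_pV2 ?posrE ?exprn_gt0 ?invr_gt0 //.
have /Num.Theory.truncn_itv/andP[_ /ltW h] : 0 <= e^-1 by rewrite invr_ge0 ltW.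
by apply: le_trans h _; rewrite -natrX ler_nat ltnW // ltn_expl.
Qed.

(** [cell_itv_set 0 0] is the interval [0, 1[, which has probability 2^-0. *)
Lemma outside_negligible i : P.-negligible [set w | ~~ (0 <= U i w < 1)].
Proof.
have m1 : measurable (U i @^-1` cell_itv_set 0 0).
  by rewrite -[_ @^-1` _]setTI; apply: measurable_funPT => //; exact: measurable_itv.
rewrite (_ : [set w | _] = ~` (U i @^-1` cell_itv_set 0 0)).
  have e : P (~` (U i @^-1` cell_itv_set 0 0)) = 0%E.
    by rewrite probability_setC // key_cell_prob // expr0 invr1 subee.
  by apply/negligibleP; first exact: measurableC.
by apply/seteqP; split => w /=; rewrite /cell_itv_set /= in_itv /= expr0 mul0r mul1r invr1;
  [move/negP|move=> /negP].
Qed.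

Lemma good_keys_prob0 : P (~` good_keys) = 0%E.
Proof.
apply/negligibleP; first exact: measurableC (sigma_measurable sigma_good_keys).
(* The diagonal pairs carry the events of leaving [0, 1), the others the ties, so that one finite
   union covers every way to fail. *)
pose B (p : 'I_n * 'I_n) : set T :=
  if p.1 == p.2 then [set w | ~~ (0 <= U p.1 w < 1)]
  else [set w | (0 <= U p.1 w < 1) && (U p.1 w == U p.2 w)].
have NB p : P.-negligible (B p).
  rewrite /B; case: p => i j /=; case: (eqVneq i j) => ij.
    exact: outside_negligible.
  exact: tie_negligible.
have NU (s : seq ('I_n * 'I_n)) : P.-negligible (\big[setU/set0]_(p <- s) B p).
  elim: s => [|p s IH]; first by rewrite big_nil; exact: negligible_set0.
  by rewrite big_cons; apply: negligibleU.
apply: (negligibleS _ (NU (index_enum _))) => w ngw.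
rewrite -bigcup_seq; apply: contrapT => nB; apply: ngw.
have nBp p : ~ B p w by move=> Bp; apply: nB; exists p; rewrite //= mem_index_enum.
have h i : 0 <= U i w < 1.
  by have := nBp (i, i); rewrite /B eqxx /= => /negP; rewrite negbK.
split => // i j ij; apply/negP => e.
by apply: (nBp (i, j)); rewrite /B /= (negbTE ij) /= h.
Qed.

Lemma good_cells_prob k (c : {ffun 'I_n -> 'I_(2 ^ k)}) :
  P (good_keys `&` [set w | forall i, cell k (U i w) = c i]) = ((2 ^+ k) ^- n)%:E.
Proof.
have mA : measurable [set w | forall i, cell_itv_set k (c i) (U i w)].
  by apply: measurable_key_rectangles; exists (fun i => cell_itv_set k (c i)) => // i; exact: measurable_itv.
have mG := sigma_measurable sigma_good_keys.
rewrite (_ : _ `&` _ = good_keys `&` [set w | forall i, cell_itv_set k (c i) (U i w)]); last first.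
  apply/seteqP; split => w [[g1 g2]] /= h; split => // i; apply/cell_itvP; rewrite ?h //;
    by have /andP[] := g1 i.
rewrite -(keys_cells_prob c) setIC.
rewrite -[in RHS](setIT [set w | _]) -(setUv good_keys) setIUr measureU.
- rewrite [X in (_ + X)%E](_ : _ = 0%E) ?adde0 //.
  apply: subset_measure0 good_keys_prob0 => //.
  + exact: measurableI _ _ mA (measurableC mG).
  + exact: measurableC.
- exact: measurableI.
- exact: measurableI _ _ mA (measurableC mG).
- by rewrite setIACA setICr setI0.
Qed.

End keys.

(** * Dependence of the cost on finite patterns of keys and pivots *)

Lemma quickselect_rec_nil (R : realType) (v : nat -> nat) fuel m :
  quickselect_rec v fuel m ([::] : seq R) = [::].
Proof. by elim: fuel m => //= fuel IH m; rewrite !IH; case: ifP => // _; case: ifP. Qed.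

(** Quickselect only consults the order of the keys: two lists indexed alike and ordered alike lead
    to the same comparisons. Valid pivot positions keep the default value of [nth] out of play. *)
Lemma quickselect_rec_iso (R : realType) (I : Type) (x y : I -> R)
    (w1 w2 : R * R -> nat) (v : nat -> nat) fuel m (s : seq I) :
  (forall i j, (x i < x j) = (y i < y j)) ->
  (forall i j, w1 (x i, x j) = w2 (y i, y j)) ->
  (forall l, (0 < l <= size s)%N -> (v l < l)%N) ->
  (\sum_(c <- quickselect_rec v fuel m [seq x i | i <- s]) w1 c =
   \sum_(c <- quickselect_rec v fuel m [seq y i | i <- s]) w2 c)%N.
Proof.
move=> xy w12; elim: fuel m s => [|fuel IH] m s vs; first by rewrite !big_nil.
case: s vs => [|i0 s'] vs; first by rewrite !quickselect_rec_nil !big_nil.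
move: (i0 :: s') vs (ltn0Sn (size s') : (0 < size (i0 :: s'))%N) => s vs s0.
have vn : (v (size s) < size s)%N by apply: vs; rewrite s0 leqnn.
rewrite /= !size_map !(nth_map i0) // !filter_map -!map_comp !big_cat !big_map !big_filter !size_map.
set p := nth i0 s (v (size s)).
have e1 : preim x (fun z => z < x p) =1 preim y (fun z => z < y p) by move=> i /=.
have e2 : preim x (fun z => x p < z) =1 preim y (fun z => y p < z) by move=> i /=.
have vf (q : pred I) l : (0 < l <= size [seq i <- s | q i])%N -> (v l < l)%N.
  move=> /andP[l0 ls]; apply: vs; rewrite l0 (leq_trans ls) // size_filter.
  exact: count_size.
congr (_ + _)%N.
  apply: eq_big => [i|i _] /=; last exact: w12.
  by rewrite !neq_lt !xy.
rewrite (eq_filter e1) (eq_filter e2).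
by case: ifP => // _; [rewrite !big_nil | case: ifP => _; apply: IH => l; apply: vf].
Qed.

(** Exactly one listed choice agrees with [u] at the lengths 1, ..., n. This writes a cost at random
    pivots as a sum over fixed pivots weighted by indicators. *)
Lemma big_pivot_choices (R : pzSemiRingType) (n : nat) (u : nat -> nat)
    (F : (nat -> nat) -> R) :
  (forall l, (0 < l <= n)%N -> (u l < l)%N) ->
  (forall v v', (forall k, (0 < k <= n)%N -> v k = v' k) -> F v = F v') ->
  \sum_(v <- pivot_choices n | [forall l : 'I_n, u l.+1 == v l.+1]) F v = F u.
Proof.
elim: n F => [|n IH] F un HF.
  rewrite big_mkcond big_seq1 ifT; last by apply/forallP => -[].
  by apply: HF => k; rewrite leqn0; case: k.
rewrite (_ : pivot_choices n.+1 =
  [seq (fun k => if k == n.+1 then j else v k) | v <- pivot_choices n, j <- iota 0 n.+1]) //.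
rewrite big_mkcond big_allpairs_dep /=.
transitivity (\sum_(v <- pivot_choices n | [forall l : 'I_n, u l.+1 == v l.+1])
  F (fun k => if k == n.+1 then u n.+1 else v k)); last first.
  rewrite IH.
  - by apply: HF => k _; case: eqP => [->|].
  - by move=> l /andP[l0 ln]; apply: un; rewrite l0 leqW.
  - by move=> v v' vv'; apply: HF => k /andP[k0 kn]; case: eqP => // kn'; apply: vv'; lia.
rewrite [RHS]big_mkcond; apply: eq_bigr => v _.
have unn : u n.+1 \in iota 0 n.+1 by rewrite mem_iota add0n un //= leqnn.
rewrite (bigD1_seq (u n.+1) unn (iota_uniq _ _)).
rewrite big1_seq => [|j /andP[jn _]]; last first.
  rewrite ifF //; apply/negbTE/forallPn; exists ord_max.
  by rewrite /= eqxx eq_sym.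
rewrite [LHS]addr0; congr (if _ then _ else _).
apply/forallP/forallP => h l; last first.
  case: (l.+1 =P n.+1) => [->//|ln].
  have ln' : (l < n)%N by have := ltn_ord l; lia.
  exact: (h (Ordinal ln')).
by have := h (widen_ord (leqnSn n) l); rewrite ifN // neq_ltn ltnS /= ltn_ord.
Qed.

Lemma pivot_choices_lt (n : nat) (v : nat -> nat) : v \in pivot_choices n ->
  forall l, (0 < l <= n)%N -> (v l < l)%N.
Proof.
elim: n v => [|n IH] v; first by move=> _ [|l].
case/allpairsP => -[v' j] [v'n]; rewrite mem_iota => jn -> l /andP[l0 ln] /=.
case: (l =P n.+1) => [->//|/eqP ln'].
by apply: (IH v' v'n); rewrite l0 /=; lia.
Qed.

Lemma pivot_mean_level_cost (R : realType) k (s : seq R) : uniq s ->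
  (forall x, x \in s -> 0 <= x < 1) ->
  pivot_mean (size s) (fun v => (\sum_(m < size s) level_cost k v m.+1 s)%:R) =
  \sum_(l < 2 ^ k) cell_cost R (count (fun x => (cell k x < l)%N) s)
     (count (fun x => cell k x == l) s) (count (fun x => (l < cell k x)%N) s).
Proof.
move=> us s01.
transitivity (\sum_(l < 2 ^ k) pivot_mean (size s) (fun v => (\sum_(m < size s)
     \sum_(c <- quickselect_rec v (size s) m.+1 s) same_cell (cell k) l c)%:R : R)); last first.
  apply: eq_bigr => l _; apply: quickselect_cell_mean => // x y; exact: cell_mono.
rewrite /pivot_mean -mulr_sumr exchange_big; congr (_ * _).
apply: eq_big_seq => v vn; rewrite -natr_sum; congr (_%:R).
rewrite exchange_big; apply: eq_bigr => m _ /=.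
rewrite exchange_big; apply: eq_big_seq => c cs /=.
have [c1 _ _] := mem_quickselect_rec (pivot_choices_lt vn) cs.
by rewrite (cell_eq_sum k c.2 (s01 _ c1)); apply: eq_bigr => l _; case: (c).
Qed.

Section costs.
Context (R : realType) d (T : measurableType d) (P : probability T R) (n : nat).
Context (U : 'I_n -> {RV P >-> R}) (V : nat -> {RV P >-> nat}).

Definition keys (w : T) : seq R := [seq U i w | i <- enum 'I_n].

Lemma size_keys w : size (keys w) = n.
Proof. by rewrite size_map size_enum_ord. Qed.

Lemma uniq_keys w : good_keys U w -> uniq (keys w).
Proof.
move=> [_ inj]; rewrite map_inj_uniq ?enum_uniq // => i j e.
by apply/eqP/negP => /negP /inj; rewrite e eqxx.
Qed.

Lemma keys01 w : good_keys U w -> forall x, x \in keys w -> 0 <= x < 1.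
Proof. by move=> [h _] x /mapP[i _ ->]. Qed.

(** Setting the cost to 0 on bad keys makes its average over the pivots equal, everywhere and not
    just almost everywhere, to a finite combination of indicators of cell patterns. *)
Definition good_level_cost (k : nat) (v : nat -> nat) (m : nat) (w : T) : nat :=
  if `[< good_keys U w >] then level_cost k v m (keys w) else 0%N.

Let GT := g_sigma_algebraType (key_rectangles U).

Lemma sigma_good_level_cost k v m j :
  (forall l, (0 < l <= n)%N -> (v l < l)%N) ->
  <<s key_rectangles U >> [set w | good_level_cost k v m w = j].
Proof.
move=> vn.
(* The cost is a function of this pattern, which takes finitely many values: the comparisons between
   keys, the coincidences of their cells, and whether the keys are good. *)
pose pat (w : T) : {ffun 'I_n * 'I_n -> bool * bool} * bool :=
  ([ffun p => (U p.1 w < U p.2 w, cell k (U p.1 w) == cell k (U p.2 w))],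
   `[< good_keys U w >]).
have mU := @measurable_key_sigma R d T P n U.
have sigma_bool (b : T -> bool) (c : bool) : measurable_fun [set: GT] (b : GT -> bool) ->
    @measurable _ GT [set w | b w = c].
  by move=> /(_ measurableT [set c] I); rewrite setTI.
have mpat q : @measurable _ GT [set w | pat w = q].
  have -> : [set w | pat w = q] = (\bigcap_(p in [set: 'I_n * 'I_n])
      ([set w | (U p.1 w < U p.2 w) = (q.1 p).1] `&`
       [set w | ((cell k (U p.1 w))%:R == (cell k (U p.2 w))%:R :> R) = (q.1 p).2]))
      `&` (if q.2 then good_keys U else ~` good_keys U).
    apply/seteqP; split => w /=.
      move=> <-; split => [p _ /=|]; first by rewrite ffunE eqr_nat.
      by rewrite /pat /=; case: asboolP.
    move=> [h1 h2]; rewrite /pat [q]surjective_pairing; congr (_, _).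
      apply/ffunP => p; rewrite ffunE; have [/= -> ] := h1 p I.
      by rewrite eqr_nat => ->; case: (q.1 p).
    by move: h2; case: q.2 => h2; apply/asboolP.
  apply: (@measurableI _ GT); last first.
    by case: q.2; [|apply: (@measurableC _ GT)]; exact: sigma_good_keys.
  apply: (@fin_bigcap_measurable _ GT) => // p _.
  apply: (@measurableI _ GT); apply: sigma_bool.
    by apply: measurable_fun_ltr; exact: mU.
  have mc i : measurable_fun [set: GT] (fun w : GT => (cell k (U i w))%:R : R).
    apply: (@measurableT_comp _ _ _ GT _ _ (fun x : R => (cell k x)%:R : R)).
      exact: cell_measurable.
    exact: mU.
  by apply: measurable_fun_eqr; exact: mc.
have inv w w' : pat w = pat w' -> good_level_cost k v m w = good_level_cost k v m w'.
  move=> [/ffunP e1 e2]; rewrite /good_level_cost e2; case: ifP => // _.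
  rewrite /level_cost /quickselect !size_keys.
  apply: (@quickselect_rec_iso R 'I_n (U ^~ w) (U ^~ w')
    (fun c => cell k c.1 == cell k c.2) (fun c => cell k c.1 == cell k c.2)).
  - by move=> i i'; have := e1 (i, i'); rewrite !ffunE /= => -[].
  - by move=> i i'; have := e1 (i, i'); rewrite !ffunE /= => -[_ ->].
  - by move=> l; rewrite size_enum_ord; apply: vn.
have -> : [set w | good_level_cost k v m w = j] =
    \bigcup_(q in [set q | exists2 w, pat w = q & good_level_cost k v m w = j]) [set w | pat w = q].
  apply/seteqP; split => w /=; first by move=> wj; exists (pat w) => //; exists w.
  by move=> [_ [w' <- <-]] /= /inv.
by apply: (@fin_bigcup_measurable _ GT) => //; apply: finite_finset.
Qed.

End costs.

(** * Integration over the random pivots *)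

Lemma natr_nneseries (R : realType) (N : nat) :
  (\sum_(0 <= j <oo) ((j < N)%N%:R : R)%:E = N%:R%:E :> \bar R)%E.
Proof.
apply: cvg_lim => //; apply: cvg_near_cst; exists N => // M /= leM.
rewrite sumEFin -natr_sum big_mkord; congr (_%:R%:E).
rewrite -[RHS]card_ord -sum1_card (big_ord_widen M (fun=> 1%N)) // [RHS]big_mkcond.
by apply: eq_bigr => k _; case: ltnP.
Qed.

(** Measurability is asked only of the members of [s]: the level costs are known to be measurable
    only for the listed, valid pivot choices. *)
Lemma ge0_integral_sum_seq d (T : measurableType d) (R : realType)
    (mu : {measure set T -> \bar R}) (D : set T) (I : eqType) (s : seq I)
    (f : I -> T -> \bar R) : measurable D ->
  (forall i, i \in s -> measurable_fun D (f i)) ->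
  (forall i x, D x -> (0 <= f i x)%E) ->
  (\int[mu]_(x in D) (\sum_(i <- s) f i x) = \sum_(i <- s) \int[mu]_(x in D) f i x)%E.
Proof.
move=> mD; case: s => [|i0 s'] mf f0.
  by rewrite big_nil (eq_integral (cst 0%E)) ?integral0 // => x _; rewrite big_nil.
move: (i0 :: s') mf => s mf.
rewrite (big_nth i0) big_mkord.
under eq_integral do rewrite (big_nth i0) big_mkord.
rewrite (ge0_integral_sum mu mD (f := fun (j : 'I_(size s)) x => f (nth i0 s j) x)) //.
- by move=> j; apply: mf; rewrite mem_nth.
- by move=> j x Dx; apply: f0.
Qed.

Section pivots.
Context (R : realType) d (T : measurableType d) (P : probability T R) (n : nat).
Context (U : 'I_n -> {RV P >-> R}) (V : nat -> {RV P >-> nat}).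
Context (U_uniform : forall (i : 'I_n) (A : set R), measurable A ->
       distribution P (U i) A = uniform_prob (ltr01 : 0 < 1 :> R) A).
Context (V_uniform : forall l j : nat, (0 < l <= n)%N -> (j < l)%N ->
       P [set w | V l w = j] = (l%:R^-1)%:E).
Context (UV : mutually_independent P (key_pivot_events U V)).

(** Writing [Y] as the sum over j of the indicators of j < Y reduces the product formula for
    integrals to [key_pivot_indep] for these events. *)
Lemma integral_pivot_indep (Y : T -> nat) v :
  (forall j, <<s key_rectangles U >> [set w | Y w = j]) ->
  (\int[P]_(w in pivot_event n V v) (Y w)%:R%:E =
   P (pivot_event n V v) * \int[P]_w (Y w)%:R%:E)%E.
Proof.
move=> sY; have mB := @measurable_pivot_event R d T P n V v.
pose A j := [set w | (j < Y w)%N].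
have sA j : <<s key_rectangles U >> (A j).
  pose GT := g_sigma_algebraType (key_rectangles U).
  have -> : A j = ~` \bigcup_(i in [set i | (i <= j)%N]) [set w | Y w = i].
    rewrite /A; apply/seteqP; split => w /=; first by move=> jY [i /= ij Yi]; rewrite Yi ltnNge ij in jY.
    by move=> h; rewrite ltnNge; apply/negP => Yj; apply: h; exists (Y w).
  apply: (@measurableC _ GT); apply: (@bigcup_measurable _ GT) => i _; exact: sY.
have mA j : measurable (A j) by exact: sigma_measurable (sA j).
have YE w : ((Y w)%:R%:E = \sum_(0 <= j <oo) (\1_(A j) w)%:E :> \bar R)%E.
  rewrite -natr_nneseries; apply: eq_eseriesr => j _; rewrite indicE.
  by congr ((nat_of_bool _)%:R%:E); apply/idP/idP => [jY|/set_mem]; rewrite ?inE.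
have intE D : measurable D ->
    (\int[P]_(w in D) (Y w)%:R%:E = \sum_(0 <= j <oo) P (A j `&` D))%E.
  move=> mD; under eq_integral do rewrite YE.
  rewrite integral_nneseries //.
    by apply: eq_eseriesr => j _; rewrite integral_indic.
  by move=> j; apply: measurableT_comp => //; exact: measurable_indic.
rewrite !intE // -[P (pivot_event n V v)]fineK ?fin_num_measure //.
rewrite -nneseriesZl //; apply: eq_eseriesr => j _.
by rewrite (key_pivot_indep UV) // setIT fineK ?fin_num_measure // muleC.
Qed.

Lemma pivot_event_probE v : (forall l, (0 < l <= n)%N -> (v l < l)%N) ->
  P (pivot_event n V v) = (n`!%:R^-1)%:E.
Proof.
move=> vn; rewrite (pivot_event_prob UV).
transitivity (\prod_(l < n) (l.+1%:R^-1 : R)%:E)%E.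
  by apply: eq_bigr => l _; apply: V_uniform; [|apply: vn]; rewrite ltn_ord.
rewrite prodEFin; congr _%:E; elim: (n) => [|m IH]; first by rewrite big_ord0 invr1.
by rewrite big_ord_recr /= IH factS natrM invfM mulrC.
Qed.

Definition valid_pivots : set T := [set w | forall l, (0 < l <= n)%N -> (V l w < l)%N].

Lemma measurable_valid_pivots : measurable valid_pivots.
Proof.
have -> : valid_pivots = \bigcap_(l in [set l | (0 < l <= n)%N]) (V l @^-1` [set j | (j < l)%N]).
  by apply/seteqP; split => w /= h l; apply: h.
apply: bigcap_measurableType => l _; rewrite -[_ @^-1` _]setTI.
exact: measurable_funPT.
Qed.

(** For each length [l], the [l] valid positions already have total probability l (1 / l) = 1. *)
Lemma valid_pivots_prob0 : P (~` valid_pivots) = 0%E.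
Proof.
apply/negligibleP; first exact: measurableC measurable_valid_pivots.
have Vl l : (0 < l <= n)%N -> P.-negligible (~` (V l @^-1` [set j | (j < l)%N])).
  move=> ln; have mV (A : set nat) : measurable (V l @^-1` A).
    by rewrite -[_ @^-1` _]setTI; exact: measurable_funPT.
  have e : P (~` (V l @^-1` [set j | (j < l)%N])) = 0%E.
    rewrite probability_setC //.
    have -> : V l @^-1` [set j | (j < l)%N] = \big[setU/set0]_(j < l) [set w | V l w = j].
      rewrite -(bigcup_mkord l (fun j => [set w | V l w = j])).
      apply/seteqP; split => w /=; first by move=> h; exists (V l w).
      by move=> [j /= jl ->].
    rewrite measure_bigsetU_ord.
    - rewrite (eq_bigr (fun=> (l%:R^-1)%:E)) => [|j _]; last exact: V_uniform.
      rewrite sumEFin sumr_const card_ord -(mulr_natl l%:R^-1) mulfV ?subee //.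
      by rewrite pnatr_eq0 -lt0n; case/andP: ln.
    - by move=> j; exact: (mV [set nat_of_ord j]).
    - by move=> i j _ _ [w [/= e1 e2]]; apply: val_inj; rewrite /= -e1 -e2.
  by apply/negligibleP; first exact: measurableC.
have NU (s : seq nat) : (forall l, l \in s -> (0 < l <= n)%N) ->
    P.-negligible (\big[setU/set0]_(l <- s) ~` (V l @^-1` [set j | (j < l)%N])).
  elim: s => [|l s IH] h; first by rewrite big_nil; exact: negligible_set0.
  rewrite big_cons; apply: negligibleU; first by apply: Vl; apply: h; rewrite mem_head.
  by apply: IH => l' l's; apply: h; rewrite inE l's orbT.
have lem : forall l, l \in iota 1 n -> (0 < l <= n)%N by move=> l; rewrite mem_iota add1n ltnS.
apply: (negligibleS _ (NU _ lem)) => w nv.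
rewrite -bigcup_seq; apply: contrapT => nB; apply: nv => l ln.
apply: contrapT => nl; apply: nB; exists l; first by rewrite /= mem_iota add1n ltnS.
exact: nl.
Qed.

End pivots.

(** * Summation over the levels and the expected cost *)

Lemma geometric_sums_series (R : realType) (n : nat) (a : nat -> R) :
  (\sum_(0 <= k <oo) (\sum_(i < n) a i.+1 / (2 ^+ k) ^+ i.+1)%:E =
   (\sum_(i < n) a i.+1 / (1 - 2 ^- i.+1))%:E)%E.
Proof.
apply: cvg_lim => //.
have h (i : nat) : series (geometric (a i.+1) (2 ^- i.+1)) @ \oo --> a i.+1 / (1 - 2 ^- i.+1).
  apply: cvg_geometric_series.
  by rewrite ger0_norm ?invr_ge0 ?exprn_ge0 // invf_lt1 ?exprn_gt0 // exprn_egt1 ?ltr1n.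
rewrite (_ : (fun M => _) = EFin \o (fun M => \sum_(i < n) series (geometric (a i.+1) (2 ^- i.+1)) M)); last first.
  apply/funext => M; rewrite /= sumEFin exchange_big /=; congr _%:E.
  apply: eq_bigr => i _; rewrite seriesEnat; apply: eq_bigr => k _.
  by rewrite /geometric /= exprVn -!exprM mulnC.
apply: cvg_EFin; first by near=> M.
elim: n => [|m IH].
  under eq_fun do rewrite big_ord0.
  by rewrite big_ord0; exact: cvg_cst.
under eq_fun do rewrite big_ord_recr /=.
by rewrite big_ord_recr /=; apply: cvgD.
Unshelve. all: end_near.
Qed.

Lemma count_keys (R : realType) d (T : measurableType d) (P : probability T R) (n : nat)
  (U : 'I_n -> {RV P >-> R}) (w : T) (q : pred R) :
  count q (keys U w) = #|finset (fun i => q (U i w))|.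
Proof.
by rewrite count_map -sum1_count -sum1dep_card big_enum_cond; apply: eq_bigl.
Qed.

Section expected.
Context (R : realType) d (T : measurableType d) (P : probability T R) (n : nat).
Context (U : 'I_n -> {RV P >-> R}) (V : nat -> {RV P >-> nat}).
Context (U_uniform : forall (i : 'I_n) (A : set R), measurable A ->
       distribution P (U i) A = uniform_prob (ltr01 : 0 < 1 :> R) A).
Context (V_uniform : forall l j : nat, (0 < l <= n)%N -> (j < l)%N ->
       P [set w | V l w = j] = (l%:R^-1)%:E).
Context (UV : mutually_independent P (key_pivot_events U V)).

Lemma measurable_good_level_cost k v m : v \in pivot_choices n ->
  measurable_fun [set: T] (fun w => (good_level_cost U k v m w)%:R%:E : \bar R).
Proof.
move=> vn _ B mB; rewrite setTI.
have -> : (fun w => (good_level_cost U k v m w)%:R%:E : \bar R) @^-1` B =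
    \bigcup_(j in [set j : nat | B (j%:R%:E)]) [set w | good_level_cost U k v m w = j].
  apply/seteqP; split => w /=; first by move=> h; exists (good_level_cost U k v m w).
  by move=> [j /= Bj ->].
apply: bigcup_measurable => j _; apply: sigma_measurable.
exact: sigma_good_level_cost (pivot_choices_lt vn).
Qed.

Lemma mu_series m : (mu P U V m = \sum_(0 <= k <oo) \sum_(v <- pivot_choices n)
   (n`!%:R^-1)%:E * \int[P]_w (good_level_cost U k v m w)%:R%:E)%E.
Proof.
rewrite /mu unlock.
(* A measurable stand-in for the cost: over the levels and the pivot choices, the cost for these
   fixed pivots on the event that they are the ones drawn. It equals the cost for good keys and
   valid pivots. *)
pose g (w : T) := (\sum_(0 <= k <oo) \sum_(v <- pivot_choices n)
  ((fun w => (good_level_cost U k v m w)%:R%:E : \bar R) \_ (pivot_event n V v)) w)%E.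
have g0 k v w : (0 <= ((fun w => (good_level_cost U k v m w)%:R%:E : \bar R) \_ (pivot_event n V v)) w)%E.
  by rewrite /patch; case: ifP => // _; rewrite lee_fin.
have mgood : measurable (good_keys U) by apply: sigma_measurable; exact: sigma_good_keys.
have mvalid := @measurable_valid_pivots R d T P n V.
rewrite (@eq_integral_off_null _ _ _ _ (~` good_keys U `|` ~` valid_pivots n V) _ g).
- rewrite /g integral_nneseries //.
  + apply: eq_eseriesr => k _; rewrite ge0_integral_sum_seq //.
      apply: eq_big_seq => v vn; rewrite -integral_mkcond (integral_pivot_indep UV).
        by rewrite (pivot_event_probE V_uniform UV (pivot_choices_lt vn)).
      by move=> j; exact: sigma_good_level_cost (pivot_choices_lt vn).
    move=> v vn; apply/(measurable_restrictT _ (measurable_pivot_event _ _ _)).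
    exact: measurable_funS (measurable_good_level_cost k m vn).
  + move=> k; rewrite (_ : (fun w => _) = (fun w => \sum_(j < size (pivot_choices n))
      ((fun w => (good_level_cost U k (nth (fun=> 0%N) (pivot_choices n) j) m w)%:R%:E : \bar R) \_ (pivot_event n V (nth (fun=> 0%N) (pivot_choices n) j))) w)%E).
      apply: emeasurable_sum => j.
      apply/(measurable_restrictT _ (measurable_pivot_event _ _ _)).
      by apply: measurable_funS (measurable_good_level_cost k m _) => //; rewrite mem_nth.
    by apply/funext => w; rewrite (big_nth (fun=> 0%N)) big_mkord.
  + by move=> k w _; apply: sume_ge0 => v _.
- by apply: measurableU; exact: measurableC.
- apply/negligibleP; first by apply: measurableU; exact: measurableC.
  apply: negligibleU; apply/negligibleP; [exact: measurableC| |exact: measurableC|].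
    exact: (good_keys_prob0 U_uniform UV).
  exact: (valid_pivots_prob0 V_uniform).
- by move=> w; rewrite lee_fin.
- by move=> w; apply: nneseries_ge0 => k _ _; apply: sume_ge0 => v _.
move=> w nN; have gw : good_keys U w by apply: contrapT => h; apply: nN; left.
have vw : valid_pivots n V w by apply: contrapT => h; apply: nN; right.
rewrite /g -[[seq U i w | i <- enum 'I_n]]/(keys U w).
rewrite -bit_comparisons_series; last 2 first.
- by move=> l; rewrite size_keys; apply: vw.
- exact: keys01.
apply: eq_eseriesr => k _.
rewrite -(@big_pivot_choices R n (V ^~ w) (fun v => (level_cost k v m (keys U w))%:R)); last 2 first.
- by move=> l; apply: vw.
- move=> v v' vv'; rewrite /level_cost /quickselect (@eq_quickselect_rec _ _ v') //.
  by move=> l; rewrite size_keys; apply: vv'.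
rewrite -sumEFin big_mkcond; apply: eq_bigr => v _.
rewrite /patch /good_level_cost; case: (asboolP (good_keys U w)) => // _.
have -> : (w \in pivot_event n V v) = [forall l : 'I_n, V l.+1 w == v l.+1].
  by apply/idP/forallP => [/set_mem h l|h]; [apply/eqP/h | apply/mem_set => l; apply/eqP/h].
by case: ifP.
Qed.

Lemma level_mean k :
  (\sum_(m < n) \sum_(v <- pivot_choices n)
     (n`!%:R^-1)%:E * \int[P]_w (good_level_cost U k v m.+1 w)%:R%:E =
   (\sum_(i < n) level_coef (bernoulli_number R) n i.+1 / (2 ^+ k) ^+ i.+1)%:E)%E.
Proof.
pose Gam (c : {ffun 'I_n -> 'I_(2 ^ k)}) : R := \sum_(l < 2 ^ k)
  cell_cost R #|finset (fun i => (c i < l)%N)| #|finset (fun i => c i == l)|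
    #|finset (fun i => (l < c i)%N)|.
pose E (c : {ffun 'I_n -> 'I_(2 ^ k)}) := good_keys U `&` [set w | forall i, cell k (U i w) = c i].
pose H w : R := \sum_(m < n) \sum_(v <- pivot_choices n)
   n`!%:R^-1 * (good_level_cost U k v m.+1 w)%:R.
have PE c : P (E c) = ((2 ^+ k) ^- n)%:E by exact: (good_cells_prob U_uniform UV).
have HE w c : E c w -> H w = Gam c.
  move=> [gw cw]; have := pivot_mean_level_cost k (uniq_keys gw) (keys01 gw).
  rewrite size_keys => e; transitivity (\sum_(l < 2 ^ k) cell_cost R
     (count (fun x => (cell k x < l)%N) (keys U w)) (count (fun x => cell k x == l) (keys U w))
     (count (fun x => (l < cell k x)%N) (keys U w))).
    rewrite -e /pivot_mean /H exchange_big mulr_sumr; apply: eq_bigr => v _.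
    rewrite natr_sum mulr_sumr; apply: eq_bigr => m _.
    by rewrite /good_level_cost asboolT.
  apply: eq_bigr => l _; rewrite !count_keys.
  by congr (cell_cost R _ _ _); apply: eq_card => i; rewrite !inE cw.
have H0 w : 0 <= H w.
  by apply: sumr_ge0 => m _; apply: sumr_ge0 => v _; rewrite mulr_ge0 ?invr_ge0.
(* The sign is not apparent from the formula. But [E c] has positive probability, so it contains an
   outcome, and there [Gam c] is the nonnegative [H]. *)
have Gam0 c : 0 <= Gam c.
  have [w Ew] : exists w, E c w.
    apply: contrapT => nE; have := PE c; rewrite (_ : E c = set0).
      rewrite measure0 => -[] /esym/eqP; apply/negP.
      by rewrite invr_eq0 !expf_neq0.
    by apply/seteqP; split => // w Ew; apply: nE; exists w.
  by rewrite -(HE w).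
have mE c : measurable (E c).
  rewrite (_ : E c = good_keys U `&` [set w | forall i, cell_itv_set k (c i) (U i w)]).
    apply: measurableI; first by apply: sigma_measurable; exact: sigma_good_keys.
    by apply: measurable_key_rectangles; exists (fun i => cell_itv_set k (c i)) => // i; exact: measurable_itv.
  by apply/seteqP; split => w [[g1 g2]] /= h; split => // i; apply/cell_itvP; rewrite ?h //;
    have /andP[] := g1 i.
(* On good keys exactly one cell pattern [c0] occurs; on bad keys both sides are 0 by the choice of
   [good_level_cost]. *)
have HS w : H w = \sum_c Gam c * \1_(E c) w.
  have [gw|ngw] := pselect (good_keys U w); last first.
    rewrite big1 => [|c _]; last by rewrite indicE memNset ?mulr0 // => -[].
    by rewrite /H big1 // => m _; rewrite big1 // => v _; rewrite /good_level_cost asboolF // mulr0.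
  pose c0 : {ffun 'I_n -> 'I_(2 ^ k)} := [ffun i => Ordinal (cell_lt k (proj1 gw i))].
  have Ec0 : E c0 w by split => // i; rewrite ffunE.
  rewrite (HE _ _ Ec0) (bigD1 c0) //= indicE mem_set // mulr1 big1 ?addr0 // => c cc0.
  rewrite indicE memNset ?mulr0 // => -[_ cw]; move/eqP: cc0; apply.
  by apply/ffunP => i; rewrite ffunE; apply: val_inj; rewrite /= cw.
transitivity (\int[P]_w (H w)%:E)%E.
  have mY := measurable_good_level_cost k.
  have HEE w : (H w)%:E = (\sum_(m < n) \sum_(v <- pivot_choices n)
     (n`!%:R^-1)%:E * (good_level_cost U k v m.+1 w)%:R%:E)%E.
    by rewrite /H -sumEFin; apply: eq_bigr => m _; rewrite -sumEFin.
  under eq_integral do rewrite HEE.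
  have i0 : 0 <= n`!%:R^-1 :> R by rewrite invr_ge0.
  rewrite ge0_integral_sum_seq //.
  - apply: eq_bigr => m _; rewrite ge0_integral_sum_seq //.
    + apply: eq_big_seq => v vn; rewrite ge0_integralZl_EFin //.
      exact: mY.
    + by move=> v vn; apply: measurable_funeM; exact: mY.
  - move=> m _; rewrite (_ : (fun w => _) = (fun w => \sum_(j < size (pivot_choices n))
      (n`!%:R^-1)%:E * (good_level_cost U k (nth (fun=> 0%N) (pivot_choices n) j) m.+1 w)%:R%:E)%E).
      by apply: emeasurable_sum => j; apply: measurable_funeM; apply: mY; rewrite mem_nth.
    by apply/funext => w; rewrite (big_nth (fun=> 0%N)) big_mkord.
  - by move=> m w _; apply: sume_ge0 => v _; rewrite /= -EFinM lee_fin mulr_ge0.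
have HSE w : (H w)%:E = (\sum_c (Gam c)%:E * (\1_(E c) w)%:E)%E.
  by rewrite HS -sumEFin.
under eq_integral do rewrite HSE.
rewrite (ge0_integral_sum P measurableT (f := fun c w => ((Gam c)%:E * (\1_(E c) w)%:E)%E)).
- transitivity (\sum_c (Gam c * (2 ^+ k) ^- n)%:E)%E.
    apply: eq_bigr => c _; rewrite ge0_integralZl_EFin //.
    + by rewrite integral_indic // setIT EFinM; congr (_ * _)%E; exact: PE.
    + by apply: measurableT_comp => //; exact: measurable_indic.
  rewrite sumEFin -mulr_suml; congr _%:E.
  have := sum_cell_cost (@bernoulli_sum R) n (N := 2 ^ k).
  by rewrite natrX => <- //; rewrite expn_gt0.
- by move=> c; apply: measurable_funeM; apply: measurableT_comp => //; exact: measurable_indic.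
- by move=> c w _; rewrite /= -EFinM lee_fin mulr_ge0.
Qed.

End expected.

Theorem mainTheorem2 (R : realType) (d : measure_display)
    (T : measurableType d) (P : probability T R) (n : nat) (hn : (2 <= n)%N)
    (U : 'I_n -> {RV P >-> R}) (V : nat -> {RV P >-> nat})
    (U_uniform : forall (i : 'I_n) (A : set R), measurable A ->
       distribution P (U i) A = uniform_prob (ltr01 : 0 < 1 :> R) A)
    (V_uniform : forall l j : nat, (0 < l <= n)%N -> (j < l)%N ->
       P [set w | V l w = j] = (l%:R^-1)%:E)
    (UV_indep : mutually_independent P (key_pivot_events U V)) :
  ((n%:R^-1)%:E * \sum_(1 <= m < n.+1) mu P U V m =
   (2 * (n%:R - 1) - 8 / n%:R * F1 R n + 4 / n%:R * F2 R n
      + 4 / 9 * F3 R n - 4 * F4 R n + 8 / n%:R * F5 R n)%:E)%E.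
Proof.
rewrite big_add1 big_mkord.
under eq_bigr do rewrite (mu_series U_uniform V_uniform UV_indep).
(* The ranks are summed inside the series over the levels, because the cost of a level is evaluated
   only after summation over all ranks. *)
rewrite -nneseries_sum; last first.
  move=> m k _; apply: sume_ge0 => v _; rewrite mule_ge0 ?lee_fin ?invr_ge0 //.
  by apply: integral_ge0 => w _; rewrite lee_fin.
rewrite (eq_eseriesr (g := fun k => (\sum_(i < n)
   level_coef (bernoulli_number R) n i.+1 / (2 ^+ k) ^+ i.+1)%:E)).
  by rewrite geometric_sums_series -EFinM sum_level_coef_closed_form.
by move=> k _; rewrite (level_mean U_uniform UV_indep).
Qed.
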